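(* Let $\Gamma \leq \mathrm{Homeo}_+(I)$ be a subgroup with $\mathcal{M}(\Gamma)=(0,1)$ such that every non-identity element of $\Gamma$ has at most $2$ fixed points in $(0,1)$. Then $\Gamma$ is semi-conjugate to an affine group, i.e. to a subgroup of $\mathrm{Aff}_+(\mathbb{R})$.
   Context: $I=[0,1]$; $\mathrm{Homeo}_+(X)$ is the group of orientation preserving homeomorphisms of $X$. Subgroups of $\mathrm{Homeo}_+(I)$ are viewed as subgroups of $\mathrm{Homeo}_+(\mathbb{R})$ by restricting to $(0,1)$ and identifying $(0,1)$ with $\mathbb{R}$ by an orientation preserving homeomorphism. $\mathrm{Aff}_+(\mathbb{R})$ is the group of orientation preserving affine homeomorphisms of $\mathbb{R}$. A minimal set of $\Gamma$ is a non-empty closed (in $(0,1)$) $\Gamma$-invariant subset of $(0,1)$ containing no proper non-empty closed $\Gamma$-invariant subset; $\mathcal{M}(\Gamma)=(0,1)$ means that $(0,1)$ itself is the (then unique) minimal set, i.e. every orbit of $\Gamma$ in $(0,1)$ is dense. Semi-conjugacy is in the usual sense: $G\leq\mathrm{Homeo}_+(\mathbb{R})$ is semi-conjugate to $G_1\leq\mathrm{Homeo}_+(\mathbb{R})$ if there are a surjective homomorphism $\rho:G\to G_1$ and a continuous non-decreasing surjective map $\theta:\mathbb{R}\to\mathbb{R}$ with $\theta\circ g=\rho(g)\circ\theta$ for all $g\in G$. *)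

(* Defs.v *)
From HB Require Import structures.
From mathcomp Require Import all_boot all_order all_algebra.
From mathcomp Require Import all_classical all_reals all_analysis.

Set Implicit Arguments.
Unset Strict Implicit.
Unset Printing Implicit Defensive.

Import Order.TTheory GRing.Theory Num.Theory numFieldNormedType.Exports.

Local Open Scope classical_set_scope.
Local Open Scope ring_scope.

(* A set of reals, seen as a type, already carries the topology induced by R;
   it is given here the induced order, so that R, [0, 1] and (0, 1) are all
   ordered topological spaces. *)
HB.instance Definition _ (R : realType) (A : set R) :=
  SubChoice.copy (set_type A) {x : R | x \in A}.
HB.instance Definition _ (R : realType) (A : set R) :=
  [SubChoice_isSubOrder of set_type A by <: with ring_display].

Definition I01 (R : realType) : set R := `[0, 1].
Definition J01 (R : realType) : set R := `]0, 1[.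
Arguments I01 : clear implicits.
Arguments J01 : clear implicits.

Lemma J01_sub_I01 (R : realType) (x : J01 R) : val x \in I01 R.
Proof.
have := set_valP x; rewrite /J01 /I01 inE /= !in_itv /= => /andP[x0 x1].
by rewrite (ltW x0) (ltW x1).
Qed.

Definition J01_incl (R : realType) (x : J01 R) : I01 R :=
  exist _ (val x) (J01_sub_I01 x).

(* On intervals, a homeomorphism preserves the orientation iff it is
   increasing. *)
Definition homeo_plus d d' (T : POrderedTopological.type d)
    (U : POrderedTopological.type d') : set (T -> U) :=
  [set f | [/\ continuous f, {homo f : x y / (x < y)%O} &
     exists g : U -> T, [/\ continuous g, cancel f g & cancel g f]]].
Arguments homeo_plus {d d'} T U.

Definition homeo_subgroup d (T : POrderedTopological.type d)
    (G : set (T -> T)) : Prop :=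
  [/\ G `<=` homeo_plus T T,
      G id,
      (forall f g, G f -> G g -> G (f \o g)) &
      (forall f g, G f -> cancel f g -> cancel g f -> G g)].

Definition invariant (T : Type) (G : set (T -> T)) (K : set T) : Prop :=
  forall g x, G g -> K x -> K (g x).

Definition minimal_set (T : topologicalType) (G : set (T -> T)) (K : set T) :
    Prop :=
  [/\ K !=set0, closed K, invariant G K &
      forall L : set T, L `<=` K -> L !=set0 -> closed L -> invariant G L ->
        L = K].

Definition restr_group (R : realType) (G : set (I01 R -> I01 R)) :
    set (J01 R -> J01 R) :=
  [set r | exists2 g, G g & forall x, J01_incl (r x) = g (J01_incl x)].

(* For h bijective, this is h G h^-1. *)
Definition transport_group (T U : Type) (h : T -> U) (G : set (T -> T)) :
    set (U -> U) :=
  [set f | exists2 r, G r & forall x, f (h x) = h (r x)].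

Definition aff_plus (R : realType) : set (R -> R) :=
  [set f | homeo_plus R R f /\ exists a b : R, forall x, f x = a * x + b].
Arguments aff_plus : clear implicits.

(* Homomorphisms G -> G1 are represented by functions on all self-maps of R,
   whose values outside G are irrelevant. *)
Definition semi_conjugate (R : realType) (G G1 : set (R -> R)) : Prop :=
  exists (rho : (R -> R) -> (R -> R)) (theta : R -> R),
    [/\ set_fun G G1 rho,
        set_surj G G1 rho &
        forall f g, G f -> G g -> rho (f \o g) = rho f \o rho g] /\
    [/\ continuous theta,
        {homo theta : x y / x <= y},
        set_surj setT setT theta &
        forall g, G g -> theta \o g = rho g \o theta].

(* Main.v *)
Require Import Defs.
From HB Require Import structures.
From mathcomp Require Import all_boot all_order all_algebra.
From mathcomp Require Import all_classical all_reals all_analysis.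
From mathcomp Require Import zify ring lra.
Import Order.TTheory GRing.Theory Num.Theory numFieldNormedType.Exports.
Local Open Scope classical_set_scope.
Local Open Scope ring_scope.

(* Since two distinct elements agree at no more than two points, comparing
   elements near +oo, resp. near -oo, gives two total bi-invariant preorders on
   the group; for an order unit u of such a preorder there is a monotone
   translation number tau with tau u = 1, whose kernel is normal and contains all
   commutators.
   If some f is of type (+,-,+), i.e. has two fixed points, moves points down
   between them and up elsewhere, then, counting coincidences of f^n with g, f is an order unit
   at both ends, and the common kernel of its two translation numbers is a
   nontrivial normal subgroup without such elements. If that subgroup still
   contains some k of type (-,+), then k and k^-1 are order units of it at +oo
   and -oo, and passing again to the kernel leaves a nontrivial normal subgroup
   whose elements move all points in the same direction; conjugation shows that
   it acts freely. Its translation number (Hölder) gives a map theta on which every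
   element of the whole group acts by an affine map. *)

Set Implicit Arguments.
Unset Strict Implicit.
Unset Printing Implicit Defensive.

(** * Translation numbers of bi-invariant preorders *)

(** Archimedean principle that removes error terms: estimates for [q]-th powers hold up to a
    constant independent of [q], so the underlying real inequality is exact. *)
Lemma natmul_bounded_le0 (R : realType) (x c : R) :
  (forall q : nat, q%:R * x <= c) -> x <= 0.
Proof.
move=> bnd; rewrite leNgt; apply/negP => x0.
have c0 : 0 <= c by have := bnd 0%N; rewrite mul0r.
have := archi_boundP (divr_ge0 c0 (ltW x0)).
by rewrite ltr_pdivrMr// ltNge bnd.
Qed.

Definition zexpg (gT : groupType) (u : gT) (z : int) : gT :=
  match z with Posz n => u ^+ n | Negz n => u ^- n.+1 end%g.

Lemma zexpgB (gT : groupType) (u : gT) (a b : nat) :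
  zexpg u (a%:Z - b%:Z) = (u ^+ a * u ^- b)%g.
Proof.
have [ab|ab] := leqP b a.
  by rewrite subzn//= expgnFr.
rewrite -opprB subzn ?(ltnW ab)//.
have [n e] : exists n, (b - a)%N = n.+1 by exists (b - a).-1; lia.
rewrite e -NegzE /= -e expgnFr ?(ltnW ab)// invgF.
by [].
Qed.

Lemma zexpgD (gT : groupType) (u : gT) (x y : int) :
  zexpg u (x + y) = (zexpg u x * zexpg u y)%g.
Proof.
have dec (z : int) : exists a b : nat, z = a%:Z - b%:Z.
  case: z => n; [exists n, 0%N|exists 0%N, n.+1]; lia.
have [a [b ->]] := dec x; have [c [d ->]] := dec y.
have -> : a%:Z - b%:Z + (c%:Z - d%:Z) = (a + c)%N%:Z - (b + d)%N%:Z by lia.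
rewrite !zexpgB expgnDr addnC expgnDr invgM.
have cm m n : commute (u ^+ m)%g (u ^- n)%g.
  by apply/commuteV/commuteX2/commute_refl.
rewrite !mulgA; congr (_ * _)%g; rewrite -!mulgA; congr (_ * _)%g.
exact: cm.
Qed.

Lemma zexpg_expg (gT : groupType) (u : gT) (x : int) (n : nat) :
  zexpg u (x * n%:Z) = (zexpg u x ^+ n)%g.
Proof.
elim: n => [|n IH]; first by rewrite mulr0.
by rewrite intS mulrDr mulr1 zexpgD IH expgS.
Qed.

Lemma zexpgN (gT : groupType) (u : gT) (x : int) : zexpg u (- x) = (zexpg u x)^-1%g.
Proof.
by apply/esym/mulg1_eq; rewrite -zexpgD subrr.
Qed.

Record biinvariant_preorder (gT : groupType) (le : gT -> gT -> Prop) : Prop := BiinvariantPreorder {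
  bo_refl : forall g, le g g;
  bo_trans : forall g h k, le g h -> le h k -> le g k;
  bo_total : forall g h, le g h \/ le h g;
  bo_mull : forall k g h, le g h -> le (k * g)%g (k * h)%g;
  bo_mulr : forall k g h, le g h -> le (g * k)%g (h * k)%g }.

Section BiinvariantPreorder.
Variables (gT : groupType) (le : gT -> gT -> Prop).
Hypothesis bo : biinvariant_preorder le.

Lemma bo_mul g h k l : le g h -> le k l -> le (g * k)%g (h * l)%g.
Proof. by move=> gh kl; apply: (bo_trans bo (bo_mulr bo k gh) (bo_mull bo h kl)). Qed.

Lemma bo_exp g h n : le g h -> le (g ^+ n)%g (h ^+ n)%g.
Proof.
move=> gh; elim: n => [|n IH]; first exact: bo_refl.
by rewrite !expgS; apply: bo_mul.
Qed.

(** If h <= g, then g^(n+1) <= h^(n+1) <= h g^n, and cancelling g^n leaves g <= h. *)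
Lemma bo_root g h n : le (g ^+ n.+1)%g (h ^+ n.+1)%g -> le g h.
Proof.
move=> ghn; have [//|hg] := bo_total bo g h.
have : le (g * g ^+ n)%g (h * g ^+ n)%g.
  by rewrite -expgS; apply: (bo_trans bo ghn); rewrite expgS; apply: (bo_mull bo); exact: bo_exp.
by move=> /(bo_mulr bo (g ^- n)%g); rewrite !mulgK.
Qed.

Lemma bo_inv g h : le g h -> le h^-1%g g^-1%g.
Proof.
move=> gh; have := bo_mull bo h^-1%g (bo_mulr bo g^-1%g gh).
by rewrite mulgV mulg1 mulKg.
Qed.

(** A substitute for commutativity in the additivity of the translation number. Since (gh)^(n+1) = g
    (hg)^n h, it suffices to bound g^n h^n by (gh)^n, by induction, and then by (hg)^n. *)
Lemma bo_exp_mul g h n : le (g * h)%g (h * g)%g ->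
  le (g ^+ n * h ^+ n)%g ((g * h) ^+ n)%g.
Proof.
move=> ghg; elim: n => [|n IH]; first by rewrite mulg1; apply: bo_refl.
have -> : ((g * h) ^+ n.+1 = g * (h * g) ^+ n * h)%g.
  elim: n {IH} => [|n IH]; first by rewrite mulg1.
  by rewrite expgS IH [in RHS]expgS !mulgA.
rewrite expgS (expgSr h) !mulgA; apply: bo_mulr => //.
rewrite -mulgA; apply: bo_mull => //.
by apply: (bo_trans bo IH); exact: bo_exp.
Qed.

Section Unit.
Variable u : gT.
Hypotheses (u1 : le 1%g u) (u1N : ~ le u 1%g).

Lemma bo_expg_ge1 n : le 1%g (u ^+ n)%g.
Proof. by rewrite -(expg1n gT n); apply: bo_exp. Qed.

Lemma bo_zexpg (a b : int) : a <= b -> le (zexpg u a) (zexpg u b).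
Proof.
move=> ab; have [n bE] : exists n : nat, b = a + n%:Z by exists `|b - a|%N; lia.
rewrite bE zexpgD -[X in le X _]mulg1; apply: bo_mull => //.
exact: bo_expg_ge1.
Qed.

Lemma bo_zexpgW (a b : int) : le (zexpg u a) (zexpg u b) -> a <= b.
Proof.
move=> uab; rewrite leNgt; apply/negP => ba; apply: u1N.
have : le (zexpg u (b + 1)) (zexpg u b).
  by apply: (bo_trans bo _ uab); apply: bo_zexpg; lia.
rewrite zexpgD => /(bo_mull bo (zexpg u b)^-1%g).
by rewrite mulKg mulVg.
Qed.

(** The first hypothesis compares p'/(q'+1) with p/(q+1). Both relations are raised to a common
    exponent of [g], and [bo_root] takes the root. *)
Lemma bo_zexpg_ratio (p p' : int) (q q' : nat) g : p' * q.+1%:Z <= p * q'.+1%:Z ->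
  le (zexpg u p) (g ^+ q.+1)%g -> le (zexpg u p') (g ^+ q'.+1)%g.
Proof.
move=> pp upg; apply: (@bo_root _ _ q); rewrite -zexpg_expg.
apply: (bo_trans bo (bo_zexpg pp)).
by rewrite zexpg_expg expgnAC; apply: bo_exp.
Qed.

End Unit.
End BiinvariantPreorder.

Record subgroup_pred (gT : groupType) (C : gT -> Prop) : Prop := SubgroupPred {
  sg1 : C 1%g;
  sgM : forall g h, C g -> C h -> C (g * h)%g;
  sgV : forall g, C g -> C g^-1%g }.

Lemma sgX (gT : groupType) (C : gT -> Prop) g n :
  subgroup_pred C -> C g -> C (g ^+ n)%g.
Proof.
move=> sC Cg; elim: n => [|n IH]; first exact: sg1.
by rewrite expgS; apply: sgM.
Qed.

Lemma sg_zexpg (gT : groupType) (C : gT -> Prop) g z :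
  subgroup_pred C -> C g -> C (zexpg g z).
Proof. by move=> sC Cg; case: z => n /=; do ?apply: sgV => //; apply: sgX. Qed.

(** The preorder compares all of [gT], but cofinality is asked only inside [C]: later the subgroup
    shrinks while the preorder stays the same. *)
Definition order_unit (gT : groupType) (le : gT -> gT -> Prop) (C : gT -> Prop)
  (u : gT) := [/\ C u, le 1%g u, ~ le u 1%g & forall g, C g -> exists n, le g (u ^+ n)%g].

Definition mono_hom (R : realType) (gT : groupType) (le : gT -> gT -> Prop)
    (C : gT -> Prop) (T : gT -> R) :=
  (forall g h, C g -> C h -> T (g * h)%g = T g + T h) /\
  (forall g h, C g -> C h -> le g h -> T g <= T h).

Section MonoHom.
Variables (R : realType) (gT : groupType) (le : gT -> gT -> Prop) (C : gT -> Prop).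
Hypotheses (bo : biinvariant_preorder le) (sC : subgroup_pred C).
Variable T : gT -> R.
Hypothesis hT : mono_hom le C T.

Lemma mh1 : T 1%g = 0.
Proof.
have := hT.1 _ _ (sg1 sC) (sg1 sC); rewrite mulg1 => /eqP.
by rewrite -subr_eq subrr => /eqP.
Qed.

Lemma mhV g : C g -> T g^-1%g = - T g.
Proof.
move=> Cg; apply/eqP; rewrite -addr_eq0 -hT.1//; last exact: sgV.
by rewrite mulVg mh1.
Qed.

Lemma mhX g n : C g -> T (g ^+ n)%g = n%:R * T g.
Proof.
move=> Cg; elim: n => [|n IH]; first by rewrite mul0r mh1.
by rewrite expgS hT.1 ?IH//; [rewrite mulrS mulrDl mul1r|exact: sgX].
Qed.

Lemma mhZ g z : C g -> T (zexpg g z) = z%:~R * T g.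
Proof.
move=> Cg; case: z => n; first exact: mhX.
by rewrite NegzE zexpgN mhV ?mulrNz ?mulNr; [rewrite mhX|exact: sgX].
Qed.

Lemma mh_ltW g h : C g -> C h -> T g < T h -> le g h.
Proof.
move=> Cg Ch gh; have [//|hg] := bo_total bo g h.
by have := hT.2 _ _ Ch Cg hg; rewrite leNgt gh.
Qed.

End MonoHom.

(** Uniqueness in Hölder's theorem. If p is the floor of q T1(d), then d^q lies between u^(p-1) and
    u^(p+1); applying [T2] determines q T2(d) up to an error independent of q. *)
Lemma mono_hom_scale (R : realType) (gT : groupType) (le : gT -> gT -> Prop)
    (C : gT -> Prop) (T1 T2 : gT -> R) (u d : gT) :
  biinvariant_preorder le -> subgroup_pred C -> mono_hom le C T1 -> mono_hom le C T2 ->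
  C u -> C d -> T1 u = 1 -> le 1%g u -> T2 d = T2 u * T1 d.
Proof.
move=> bo sC h1 h2 Cu Cd T1u leu.
have T2u : 0 <= T2 u by rewrite -(mh1 sC h2); apply: h2.2 => //; exact: sg1.
suff bnd q : `|q%:R * (T2 d - T2 u * T1 d)| <= 2 * T2 u.
  apply/eqP; rewrite -subr_eq0 eq_le; apply/andP; split.
    apply: (@natmul_bounded_le0 _ _ (2 * T2 u)) => q.
    by apply: le_trans (bnd q); exact: ler_norm.
  rewrite -oppr_le0; apply: (@natmul_bounded_le0 _ _ (2 * T2 u)) => q.
  by apply: le_trans (bnd q); rewrite mulrN lerNl; apply: lerNnormlW.
have Cq : C (d ^+ q)%g by exact: sgX.
have fl := floor_itv (q%:R * T1 d).
set p := Num.floor _ in fl.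
have [fl1 fl2] := andP fl.
(* [mh_ltW] needs a strict inequality and the floor gives only p <= q T1(d), hence the exponent
   [p - 1]. *)
have lo : T2 (zexpg u (p - 1)) <= T2 (d ^+ q)%g.
  apply: h2.2 => //; first exact: sg_zexpg.
  apply: (mh_ltW bo h1) => //; first exact: sg_zexpg.
  rewrite (mhZ sC h1)// (mhX sC h1)// T1u mulr1 intrB.
  by move: fl1 fl2; lra.
have hi : T2 (d ^+ q)%g <= T2 (zexpg u (p + 1)).
  apply: h2.2 => //; first exact: sg_zexpg.
  apply: (mh_ltW bo h1) => //; first exact: sg_zexpg.
  by rewrite (mhZ sC h1)// (mhX sC h1)// T1u mulr1.
move: lo hi; rewrite !(mhZ sC h2)// (mhX sC h2)// intrB intrD.
rewrite intrD in fl2.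
move: fl1 fl2 T2u; move: (T2 u) (T2 d) (T1 d) (p%:~R) (q%:R) => a b c P Q.
move=> H1 H2 H3 H4 H5; rewrite ler_norml; apply/andP; split; nra.
Qed.

(** * The translation number relative to an order unit *)

Section Tau.
Variables (R : realType) (gT : groupType) (le : gT -> gT -> Prop) (C : gT -> Prop).
Hypotheses (bo : biinvariant_preorder le) (sC : subgroup_pred C).
Variable u : gT.
Hypothesis hu : order_unit le C u.

(** The Dedekind cut of the fractions p/q with u^p <= g^q; writing the denominator as [q.+1] keeps
    it positive. *)
Definition transl_num_cut (g : gT) : set R :=
  [set x | exists (p : int) (q : nat),
     le (zexpg u p) (g ^+ q.+1)%g /\ x = p%:~R / q.+1%:R].
Definition transl_num (g : gT) : R := sup (transl_num_cut g).

Let u1 : le 1%g u. Proof. by case: hu. Qed.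
Let u1N : ~ le u 1%g. Proof. by case: hu. Qed.

Lemma transl_num_has_sup g : C g -> has_sup (transl_num_cut g).
Proof.
case: hu => Cu _ _ unit Cg; split.
  have [n gn] := unit _ (sgV sC Cg).
  exists ((- n%:Z)%:~R / 1%:R), (- n%:Z), 0%N; split => //.
  by rewrite zexpgN expg1 -[g]invgK; apply: bo_inv.
have [n gn] := unit _ Cg.
exists n%:R => _ [p [q [upg ->]]].
rewrite ler_pdivrMr ?ltr0n//.
have : le (zexpg u p) (zexpg u (n * q.+1)%:Z).
  by apply: (bo_trans bo upg); rewrite /= expgnA; apply: bo_exp.
move=> /(bo_zexpgW bo u1 u1N).
by rewrite -(ler_int R) => /le_trans; apply; rewrite -natrM.
Qed.

Lemma transl_num_lb g (p : int) (q : nat) : C g ->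
  le (zexpg u p) (g ^+ q.+1)%g -> p%:~R <= q.+1%:R * transl_num g.
Proof.
move=> Cg upg; rewrite mulrC -ler_pdivrMr ?ltr0n//.
by apply: ub_le_sup; [exact: (transl_num_has_sup Cg).2|exists p, q].
Qed.

(** By [bo_zexpg_ratio] the cut contains every fraction below one of its members, so a fraction
    outside it is an upper bound. *)
Lemma transl_num_ub g (p : int) (q : nat) : C g ->
  ~ le (zexpg u p) (g ^+ q.+1)%g -> q.+1%:R * transl_num g <= p%:~R.
Proof.
move=> Cg upg; rewrite mulrC -ler_pdivlMr ?ltr0n//.
apply: ge_sup; first exact: (transl_num_has_sup Cg).1.
move=> _ [p' [q' [upg' ->]]].
rewrite leNgt; apply/negP; rewrite ltr_pdivlMr ?ltr0n// mulrAC ltr_pdivrMr ?ltr0n//.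
move=> lt; apply: upg; apply: (bo_zexpg_ratio bo u1) upg'.
move: (ltW lt); rewrite !pmulrn -!intrM ler_int; lia.
Qed.

(** Whichever of gh and hg is smaller, [bo_exp_mul] turns u^a <= g^q and u^b <= h^q into u^(a+b) <=
    (gh)^q. Here a and b lose at most 2 each, whence the bound 4. *)
Lemma transl_num_superadd g h : C g -> C h -> transl_num g + transl_num h <= transl_num (g * h)%g.
Proof.
move=> Cg Ch; rewrite -subr_le0; apply: (@natmul_bounded_le0 _ _ 4) => q.
case: q => [|q]; first by rewrite mul0r.
(* The witness is one less than the floor: were u^p <= k^q false, [transl_num_ub] would bound q T(k)
   by the floor minus one. *)
have below k : C k -> exists p : int, le (zexpg u p) (k ^+ q.+1)%g /\
    q.+1%:R * transl_num k <= p%:~R + 2.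
  move=> Ck; have /andP[f1 f2] := floor_itv (q.+1%:R * transl_num k).
  exists (Num.floor (q.+1%:R * transl_num k) - 1); split; last first.
    by move: f2; rewrite intrD intrB; lra.
  apply: contrapT => /(transl_num_ub Ck); move: f1; rewrite intrB; lra.
have [a [ua ta]] := below _ Cg; have [b [ub tb]] := below _ Ch.
have : le (zexpg u (a + b)) ((g * h) ^+ q.+1)%g.
  have [gh|hg] := bo_total bo (g * h)%g (h * g)%g.
    apply: (bo_trans bo _ (bo_exp_mul bo q.+1 gh)).
    by rewrite zexpgD; apply: bo_mul.
  apply: (bo_trans bo _ (bo_exp bo q.+1 hg)).
  apply: (bo_trans bo _ (bo_exp_mul bo q.+1 hg)).
  by rewrite addrC zexpgD; apply: bo_mul.
move=> /(transl_num_lb (sgM sC Cg Ch)); rewrite intrD; lra.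
Qed.

Lemma transl_num_unit : transl_num u = 1.
Proof.
have Cu : C u by case: hu.
apply/eqP; rewrite eq_le; apply/andP; split; last first.
  have := @transl_num_lb u 1 0 Cu; rewrite mul1r; apply; exact: bo_refl.
apply: ge_sup; first exact: (transl_num_has_sup Cu).1.
move=> _ [p [q [upq ->]]]; rewrite ler_pdivrMr ?ltr0n// mul1r.
by have := bo_zexpgW bo u1 u1N (b := q.+1) upq; rewrite -(ler_int R).
Qed.

(** Superadditivity applied to gh and h^-1, together with -T(h) <= T(h^-1), gives the reverse
    inequality. Monotonicity is inclusion of cuts. *)
Lemma transl_num_mono_hom : mono_hom le C transl_num.
Proof.
have tauV g : C g -> - transl_num g <= transl_num g^-1%g.
  move=> Cg; rewrite -subr_le0; apply: (@natmul_bounded_le0 _ _ 2) => q.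
  case: q => [|q]; first by rewrite mul0r.
  have /andP[f1 f2] := floor_itv (q.+1%:R * transl_num g).
  have : le (zexpg u (- (Num.floor (q.+1%:R * transl_num g) + 1))) (g^-1 ^+ q.+1)%g.
    rewrite zexpgN expVgn; apply: bo_inv => //.
    have [//|] := bo_total bo (g ^+ q.+1)%g
      (zexpg u (Num.floor (q.+1%:R * transl_num g) + 1)).
    by move/(transl_num_lb Cg); rewrite leNgt f2.
  move=> /(transl_num_lb (sgV sC Cg)); move: f1 f2; rewrite mulrNz !intrD; lra.
split=> [g h Cg Ch|g h Cg Ch gh].
  apply/eqP; rewrite eq_le transl_num_superadd// andbT.
  have := transl_num_superadd (sgM sC Cg Ch) (sgV sC Ch); rewrite mulgK.
  by have := tauV _ Ch; lra.
have [Cu _ _ _] := hu.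
apply: le_sup.
- move=> _ [p [q [upg ->]]]; exists (p%:~R / q.+1%:R); split => //.
  exists p, q; split=> //; apply: (bo_trans bo upg); exact: bo_exp.
- exact: (transl_num_has_sup Cg).1.
- exact: transl_num_has_sup.
Qed.

End Tau.

(** * Actions on the line with at most two fixed points per element *)

Lemma ivt_fixed (R : realType) (f : R -> R) (x y : R) : continuous f ->
  x < y -> (f x - x) * (f y - y) < 0 -> exists z, [/\ x < z, z < y & f z = z].
Proof.
move=> cf xy fxy.
have cont : {within `[x, y], continuous (fun t => f t - t)}.
  by apply: continuous_subspaceT => w; apply: continuousB; [exact: cf|exact: cvg_id].
have [|z /itvP zxy /eqP] := @IVT R (fun t => f t - t) x y 0 (ltW xy) cont.
  by rewrite minEle maxEle; case: ifP; nra.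
rewrite subr_eq0 => /eqP fz; exists z.
have [zx zy] : z != x /\ z != y.
  by split; apply/eqP => e; move: fxy; rewrite -e fz subrr ?mul0r ?mulr0 ltxx.
by split=> //; rewrite lt_neqAle zxy andbT // eq_sym.
Qed.

Record sparse_action (R : realType) (gT : groupType) (act : gT -> R -> R) : Prop :=
  SparseAction {
  sa1 : forall x, act 1%g x = x;
  saM : forall g h x, act (g * h)%g x = act g (act h x);
  sa_lt : forall g x y, x < y -> act g x < act g y;
  sa_cont : forall g, continuous (act g);
  sa_fix : forall g x y z, x < y -> y < z ->
    act g x = x -> act g y = y -> act g z = z -> g = 1%g;
  sa_dense : forall x a b, a < b -> exists2 g, a < act g x & act g x < b }.

(** Type (+,-,+). The inverse of such an element shows the signs (-,+,-). *)
Definition crossing (R : realType) (f : R -> R) :=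
  exists x y z, [/\ x < y, y < z & [/\ x < f x, f y < y & z < f z]].

(** Type (-,+). *)
Definition expanding (R : realType) (f : R -> R) :=
  exists x y, [/\ x < y, f x < x & y < f y].

Definition normal_pred (gT : groupType) (C : gT -> Prop) :=
  subgroup_pred C /\ forall h c, C c -> C (h * c * h^-1)%g.

(** Comparison of germs at +oo. *)
Definition act_le_pinfty (R : realType) (gT : groupType) (act : gT -> R -> R) (g h : gT) :=
  exists M, forall x, M <= x -> act g x <= act h x.

Definition act_le_ninfty (R : realType) (gT : groupType) (act : gT -> R -> R) (g h : gT) :=
  exists M, forall x, x <= M -> act g x <= act h x.

Lemma normal_setT (gT : groupType) : normal_pred (fun _ : gT => True).
Proof. by []. Qed.

Section Action.
Variables (R : realType) (gT : groupType) (act : gT -> R -> R).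
Hypothesis sa : sparse_action act.
Local Notation lepoo := (act_le_pinfty act).
Local Notation lenoo := (act_le_ninfty act).

Lemma actK g x : act g^-1%g (act g x) = x.
Proof. by rewrite -(saM sa) mulVg (sa1 sa). Qed.

Lemma actVK g x : act g (act g^-1%g x) = x.
Proof. by rewrite -(saM sa) mulgV (sa1 sa). Qed.

Lemma act_ltE g x y : (act g x < act g y) = (x < y).
Proof.
apply/idP/idP; last exact: sa_lt.
by move=> /(sa_lt sa g^-1%g); rewrite !actK.
Qed.

Lemma act_leE g x y : (act g x <= act g y) = (x <= y).
Proof. by rewrite !leNgt act_ltE. Qed.

Lemma act_ltV g x y : (act g^-1%g x < y) = (x < act g y).
Proof. by rewrite -(act_ltE g) actVK. Qed.

Lemma act_gtV g x y : (x < act g^-1%g y) = (act g x < y).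
Proof. by rewrite -(act_ltE g) actVK. Qed.

Lemma actXS g n x : act (g ^+ n.+1)%g x = act g (act (g ^+ n)%g x).
Proof. by rewrite expgS (saM sa). Qed.

Lemma act_conj g h x : act (h * g * h^-1)%g (act h x) = act h (act g x).
Proof. by rewrite !(saM sa) actK. Qed.

(** Three sign changes produce three fixed points, so [g] is the identity, which moves nothing. The
    relative version below applies this to f^-1 g, whose fixed points are the coincidences of f and
    g. *)
Lemma no_alternation4 g x y z w : x < y -> y < z -> z < w ->
  x < act g x -> act g y < y -> z < act g z -> act g w < w -> False.
Proof.
move=> xy yz zw gx gy gz gw.
have [|a [xa ay ga]] := ivt_fixed (@sa_cont _ _ _ sa g) xy; first by nra.
have [|b [yb bz gb]] := ivt_fixed (@sa_cont _ _ _ sa g) yz; first by nra.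
have [|c [zc cw gc]] := ivt_fixed (@sa_cont _ _ _ sa g) zw; first by nra.
have g1 := sa_fix sa (lt_trans ay yb) (lt_trans bz zc) ga gb gc.
by move: gx; rewrite g1 (sa1 sa) ltxx.
Qed.

Lemma no_alternation4_rel f g x y z w : x < y -> y < z -> z < w ->
  act f x < act g x -> act g y < act f y -> act f z < act g z ->
  act g w < act f w -> False.
Proof.
move=> xy yz zw hx hy hz hw.
by apply: (@no_alternation4 (f^-1 * g)%g x y z w) => //;
  rewrite (saM sa) ?act_gtV ?act_ltV.
Qed.

Lemma fixed_bounded g : g <> 1%g ->
  exists lo hi, forall x, act g x = x -> lo < x /\ x < hi.
Proof.
move=> g1.
have [hi hiP] : exists hi, forall x, act g x = x -> x < hi.
  apply: contrapT => /forallNP unb.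
  have ex M : exists2 x, M < x & act g x = x.
    have /existsNP[x /not_implyP[gx /negP]] := unb (M + 1).
    by rewrite -leNgt => Mx; exists x => //; lra.
  have [x _ gx] := ex 0; have [y xy gy] := ex x; have [z yz gz] := ex y.
  exact: g1 (sa_fix sa xy yz gx gy gz).
have [lo loP] : exists lo, forall x, act g x = x -> lo < x.
  apply: contrapT => /forallNP unb.
  have ex M : exists2 x, x < M & act g x = x.
    have /existsNP[x /not_implyP[gx /negP]] := unb (M - 1).
    by rewrite -leNgt => Mx; exists x => //; lra.
  have [x _ gx] := ex 0; have [y xy gy] := ex x; have [z yz gz] := ex y.
  exact: g1 (sa_fix sa yz xy gz gy gx).
by exists lo, hi => x gx; split; [exact: loP|exact: hiP].
Qed.

Lemma act_le_pinfty_preorder : biinvariant_preorder lepoo.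
Proof.
split.
- by move=> g; exists 0.
- move=> g h k [M gh] [N hk]; exists (Order.max M N) => x; rewrite ge_max => /andP[Mx Nx].
  exact: le_trans (gh _ Mx) (hk _ Nx).
(* If neither element is eventually below the other, four points further and further out have
   alternating signs. *)
- move=> g h; apply: contrapT => /not_orP[/forallNP gh /forallNP hg].
  have ex1 M : exists2 x, M < x & act h x < act g x.
    have /existsNP[x /not_implyP[Mx /negP]] := gh (M + 1).
    by rewrite -ltNge => ?; exists x => //; lra.
  have ex2 M : exists2 x, M < x & act g x < act h x.
    have /existsNP[x /not_implyP[Mx /negP]] := hg (M + 1).
    by rewrite -ltNge => ?; exists x => //; lra.
  have [x _ hx] := ex1 0; have [y xy hy] := ex2 x.
  have [z yz hz] := ex1 y; have [w zw hw] := ex2 z.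
  exact: no_alternation4_rel xy yz zw hx hy hz hw.
- by move=> k g h [M gh]; exists M => x /gh; rewrite !(saM sa) act_leE.
- move=> k g h [M gh]; exists (act k^-1%g M) => x.
  by rewrite -(act_leE k) actVK !(saM sa) => /gh.
Qed.

Lemma act_le_ninfty_preorder : biinvariant_preorder lenoo.
Proof.
split.
- by move=> g; exists 0.
- move=> g h k [M gh] [N hk]; exists (Order.min M N) => x; rewrite le_min => /andP[Mx Nx].
  exact: le_trans (gh _ Mx) (hk _ Nx).
- move=> g h; apply: contrapT => /not_orP[/forallNP gh /forallNP hg].
  have ex1 M : exists2 x, x < M & act h x < act g x.
    have /existsNP[x /not_implyP[Mx /negP]] := gh (M - 1).
    by rewrite -ltNge => ?; exists x => //; lra.
  have ex2 M : exists2 x, x < M & act g x < act h x.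
    have /existsNP[x /not_implyP[Mx /negP]] := hg (M - 1).
    by rewrite -ltNge => ?; exists x => //; lra.
  have [x _ hx] := ex1 0; have [y xy hy] := ex2 x.
  have [z yz hz] := ex1 y; have [w zw hw] := ex2 z.
  exact: no_alternation4_rel zw yz xy hw hz hy hx.
- by move=> k g h [M gh]; exists M => x /gh; rewrite !(saM sa) act_leE.
- move=> k g h [M gh]; exists (act k^-1%g M) => x.
  by rewrite -(act_leE k) actVK !(saM sa) => /gh.
Qed.

(** If the orbit stayed below [K], its supremum would lie in [J] and be moved up by [f]. Its
    preimage is then smaller, so some orbit point exceeds the preimage and the next one exceeds the
    supremum. [J] allows for intervals bounded by fixed points. *)
Lemma iter_up (J : R -> Prop) f a K : J a -> J K ->
  (forall x y z, J x -> J z -> x <= y -> y <= z -> J y) ->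
  (forall x, J x -> J (act f x) /\ x < act f x) ->
  exists n0, forall n, (n0 <= n)%N -> K < act (f ^+ n)%g a.
Proof.
move=> Ja JK convex Jf.
have Jn n : J (act (f ^+ n)%g a).
  by elim: n => [|n /Jf[]]; [rewrite (sa1 sa)|rewrite actXS].
have incr n m : (n <= m)%N -> act (f ^+ n)%g a <= act (f ^+ m)%g a.
  move=> /subnK <-; elim: (m - n)%N => // k /le_trans; apply.
  by rewrite actXS; have [_ /ltW] := Jf _ (Jn (k + n)%N).
suff [n Kn] : exists n, K < act (f ^+ n)%g a.
  by exists n => m nm; apply: lt_le_trans Kn (incr _ _ nm).
apply: contrapT => /forallNP bnd.
have bndK n : act (f ^+ n)%g a <= K by rewrite leNgt; apply/negP.
pose S := range (fun n => act (f ^+ n)%g a).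
have supS : has_sup S.
  split; first by exists (act (f ^+ 0)%g a), 0%N.
  by exists K => _ [n _ <-].
have Sle n : act (f ^+ n)%g a <= sup S by apply: (ub_le_sup supS.2); exists n.
have Js : J (sup S).
  apply: convex Ja JK _ _; first by rewrite -[a in a <= _](sa1 sa); exact: (Sle 0%N).
  by apply: ge_sup => [|_ [n _ <-]]; [exact: supS.1|].
have [_ sfs] := Jf _ Js.
have : act f^-1%g (sup S) < sup S by rewrite act_ltV.
move=> /(sup_gt supS.1)[_ [n _ <-]].
by rewrite act_ltV -actXS ltNge Sle.
Qed.

Lemma iter_down (J : R -> Prop) f a K : J a -> J K ->
  (forall x y z, J x -> J z -> x <= y -> y <= z -> J y) ->
  (forall x, J x -> J (act f x) /\ act f x < x) ->
  exists n0, forall n, (n0 <= n)%N -> act (f ^+ n)%g a < K.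
Proof.
move=> Ja JK convex Jf.
have Jn n : J (act (f ^+ n)%g a).
  by elim: n => [|n /Jf[]]; [rewrite (sa1 sa)|rewrite actXS].
have decr n m : (n <= m)%N -> act (f ^+ m)%g a <= act (f ^+ n)%g a.
  move=> /subnK <-; elim: (m - n)%N => // k; apply: le_trans.
  by rewrite actXS; have [_ /ltW] := Jf _ (Jn (k + n)%N).
suff [n Kn] : exists n, act (f ^+ n)%g a < K.
  by exists n => m nm; apply: le_lt_trans (decr _ _ nm) Kn.
apply: contrapT => /forallNP bnd.
have bndK n : K <= act (f ^+ n)%g a by rewrite leNgt; apply/negP.
pose S := range (fun n => act (f ^+ n)%g a).
have infS : has_inf S.
  split; first by exists (act (f ^+ 0)%g a), 0%N.
  by exists K => _ [n _ <-].
have Sge n : inf S <= act (f ^+ n)%g a by apply: (ge_inf infS.2); exists n.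
have Js : J (inf S).
  apply: convex JK Ja _ _; last by rewrite -[a in _ <= a](sa1 sa); exact: (Sge 0%N).
  by apply: lb_le_inf => [|_ [n _ <-]]; [exact: infS.1|].
have [_ sfs] := Jf _ Js.
have : inf S < act f^-1%g (inf S) by rewrite act_gtV.
move=> /(inf_lt infS.1)[_ [n _ <-]].
by rewrite act_gtV -actXS ltNge Sge.
Qed.

(** * Elements of type (+,-,+) *)

Record crossing_pair (f : gT) (a b : R) : Prop := CrossingPair {
  cp_lt : a < b;
  cp_a : act f a = a;
  cp_b : act f b = b;
  cp_left : forall x, x < a -> x < act f x;
  cp_mid : forall x, a < x -> x < b -> act f x < x;
  cp_right : forall x, b < x -> x < act f x }.

(** The two fixed points given by the intermediate value theorem are the only ones, so on each
    complementary interval the sign is that of the given point in it. *)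
Lemma crossing_pairP f : crossing (act f) -> exists a b, crossing_pair f a b.
Proof.
move=> [x [y [z [xy yz [fx fy fz]]]]].
have [|a [xa ay fa]] := ivt_fixed (@sa_cont _ _ _ sa f) xy; first by nra.
have [|b [yb bz fb]] := ivt_fixed (@sa_cont _ _ _ sa f) yz; first by nra.
have ab := lt_trans ay yb.
have f1 : f <> 1%g by move=> f1; move: fx; rewrite f1 (sa1 sa) ltxx.
have only t : act f t = t -> t = a \/ t = b.
  move=> ft; have [ta|ta|->] := ltgtP t a; last by left.
    by case: f1; exact: (sa_fix sa ta ab).
  have [tb|tb|->] := ltgtP t b; last by right.
    by case: f1; exact: (sa_fix sa ta tb).
  by case: f1; exact: (sa_fix sa ab tb).
have nosign s t : s < t -> (act f s - s) * (act f t - t) < 0 ->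
    (s < a < t) \/ (s < b < t).
  move=> st /(ivt_fixed (@sa_cont _ _ _ sa f) st)[w [sw wt /only[] wE]].
    by left; rewrite -wE sw.
  by right; rewrite -wE sw.
have neq t : t <> a -> t <> b -> act f t < t \/ t < act f t.
  move=> ta tb; have [|?|/only[]//] := ltgtP (act f t) t; first by left.
  by right.
exists a, b; split=> // t.
- move=> ta; have [||ft|//] := neq t; [by move=> e; move: ta; rewrite e; lra..|].
  have [tx|xt|tx] := ltgtP t x; last by move: ft fx; rewrite tx; lra.
    by have [||] := nosign _ _ tx; [nra|lra..].
  by have [||] := nosign _ _ xt; [nra|lra..].
- move=> ta tb; have [||//|ft] := neq t; [by move=> e; move: ta tb; rewrite e; lra..|].
  have [ty|yt|ty] := ltgtP t y; last by move: ft fy; rewrite ty; lra.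
    by have [||] := nosign _ _ ty; [nra|lra..].
  by have [||] := nosign _ _ yt; [nra|lra..].
- move=> tb; have [||ft|//] := neq t; [by move=> e; move: tb; rewrite e; lra..|].
  have [tz|zt|tz] := ltgtP t z; last by move: ft fz; rewrite tz; lra.
    by have [||] := nosign _ _ tz; [nra|lra..].
  by have [||] := nosign _ _ zt; [nra|lra..].
Qed.

Lemma crossing_pair_conj f a b h : crossing_pair f a b ->
  crossing_pair (h * f * h^-1)%g (act h a) (act h b).
Proof.
case=> ab fa fb fl fm fr; split.
- by rewrite act_ltE.
- by rewrite act_conj fa.
- by rewrite act_conj fb.
- by move=> x; rewrite -[x](actVK h) act_conj !act_ltE; exact: fl.
- by move=> x; rewrite -[x](actVK h) act_conj !act_ltE; exact: fm.
- by move=> x; rewrite -[x](actVK h) act_conj !act_ltE; exact: fr.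
Qed.

(* Otherwise f^n - g would take the signs +, -, + at three points z < x < y and be
   negative again arbitrarily far out. *)
Lemma crossing_pair_dominates f a b g : crossing_pair f a b -> a < act g b ->
  (exists n, lepoo g (f ^+ n)%g) /\ (exists n, lenoo g (f ^+ n)%g).
Proof.
case=> ab fa fb fl fm fr agb.
have [x [ax xb agx]] : exists x, [/\ a < x, x < b & a < act g x].
  (* Any point between this maximum and [b] works: the iterates of [f] descend from it towards [a],
     while its image under [g] stays above [a]. *)
  exists ((Order.max a (act g^-1%g a) + b) / 2).
  have gab : act g^-1%g a < b by rewrite act_ltV.
  by rewrite -act_ltV maxEle; case: ifP => ?; split; lra.
have [n1 n1P] : exists n0, forall n, (n0 <= n)%N -> act (f ^+ n)%g x < act g x.
  pose K := Order.min x (act g x).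
  have [aK Kx Kg] : [/\ a < K, K <= x & K <= act g x].
    by rewrite /K minEle; case: ifP => ?; split; lra.
  have [||||n0 n0P] := @iter_down (fun t => a < t < b) f x K.
  - by rewrite ax.
  - by rewrite aK; lra.
  - by move=> t v w; lra.
  - move=> t /andP[at_ tb]; split; last exact: fm.
    by rewrite -[X in X < _ < _]fa -[X in _ < _ < X]fb !act_ltE at_.
  by exists n0 => n /n0P /lt_le_trans; apply.
pose y := b + 1.
have [n2 n2P] : exists n0, forall n, (n0 <= n)%N -> act g y < act (f ^+ n)%g y.
  have [||||n0 n0P] := @iter_up (fun t => y <= t) f y (Order.max y (act g y)).
  - by [].
  - by rewrite le_max lexx.
  - by move=> t v w; lra.
  - by move=> t yt; have := fr t; rewrite /y in yt *; lra.
  by exists n0 => n /n0P; apply: le_lt_trans; rewrite le_max lexx orbT.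
(* Both [z] and its image under [g] lie below [a], so the iterates of [f], which climb from [z]
   towards [a], overtake that image. *)
pose z := Order.min a (act g^-1%g a) - 1.
have [za gza] : z < a /\ act g z < a.
  by rewrite -act_gtV /z minEle; case: ifP => ?; split; lra.
have [n3 n3P] : exists n0, forall n, (n0 <= n)%N -> act g z < act (f ^+ n)%g z.
  have [||||n0 n0P] := @iter_up (fun t => z <= t < a) f z (Order.max z (act g z)).
  - by rewrite lexx.
  - by rewrite le_max lexx gt_max za gza.
  - by move=> t v w; lra.
  - move=> t /andP[zt ta]; have tft := fl _ ta; split=> //.
    by rewrite -[X in _ < X]fa act_ltE ta andbT; lra.
  by exists n0 => n /n0P; apply: le_lt_trans; rewrite le_max lexx orbT.
pose n := maxn n1 (maxn n2 n3).
have {n1P} fx : act (f ^+ n)%g x < act g x by apply: n1P; lia.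
have {n2P} fy : act g y < act (f ^+ n)%g y by apply: n2P; lia.
have {n3P} fz : act g z < act (f ^+ n)%g z by apply: n3P; lia.
have zx : z < x by lra.
have xy : x < y by rewrite /y; lra.
split; exists n; apply: contrapT => /forallNP.
  move=> /(_ (y + 1))/existsNP[w /not_implyP[yw /negP]]; rewrite -ltNge => fw.
  by apply: (no_alternation4_rel zx xy _ fz fx fy fw); lra.
move=> /(_ (z - 1))/existsNP[w /not_implyP[wz /negP]]; rewrite -ltNge => fw.
by apply: (no_alternation4_rel _ zx xy fw fz fx fy); lra.
Qed.

Lemma dense_gt x M : exists g, M < act g x.
Proof.
by have [|g Mg _] := sa_dense sa x (a := M) (b := M + 1); [lra|exists g].
Qed.

Lemma dense_lt x M : exists g, act g x < M.
Proof.
by have [|g _ Mg] := sa_dense sa x (a := M - 1) (b := M); [lra|exists g].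
Qed.

Section Cofinal.
Variable le : gT -> gT -> Prop.
Hypothesis bo : biinvariant_preorder le.
Hypothesis le_dom : forall f a b g, crossing_pair f a b -> a < act g b ->
  exists n, le g (f ^+ n)%g.
Hypothesis le_shrink : forall f a b g, crossing_pair f a b -> ~ le g f ->
  exists h, act h b < act g (act h b).

(** [le_dom] applies only when a < g(b), so domination is chained: powers of hfh^-1 dominate g,
    those of kfk^-1 dominate hfh^-1, and those of f dominate kfk^-1. Here k moves a beyond both b
    and h(b), which makes each link satisfy the condition. *)
Lemma crossing_cofinal f g : crossing (act f) -> exists n, le g (f ^+ n)%g.
Proof.
move=> /crossing_pairP[a [b fab]]; apply: contrapT => nle.
have trans k l m : (exists n, le k (l ^+ n)%g) -> (exists n, le m (k ^+ n)%g) ->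
    exists n, le m (l ^+ n)%g.
  move=> [n kl] [p mk]; exists (n * p)%N; apply: (bo_trans bo mk).
  by rewrite expgnA; exact: bo_exp.
have nf : ~ le g f by move=> gf; apply: nle; exists 1%N.
have [h gh] := le_shrink fab nf; apply: nle.
have fhab := crossing_pair_conj h fab.
apply: (trans (h * f * h^-1)%g); last first.
  by apply: (le_dom fhab); apply: lt_trans gh; rewrite act_ltE; case: fab.
have [k kP] := dense_gt a (Order.max b (act h b)).
have [bk hk] : b < act k a /\ act h b < act k a.
  by apply/andP; rewrite -gt_max.
have fkab := crossing_pair_conj k fab.
have ab := cp_lt fab.
apply: (trans (k * f * k^-1)%g).
  by apply: (le_dom fab); apply: (lt_trans ab); exact: cp_left fkab _ bk.
have kab : act k a < act k b by rewrite act_ltE.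
apply: (le_dom fkab); apply: (lt_trans kab).
exact: (cp_right fhab (lt_trans hk kab)).
Qed.

End Cofinal.
End Action.

(** * A free normal subgroup *)

Lemma mono_hom_conj (R : realType) (gT : groupType) (le : gT -> gT -> Prop)
    (C : gT -> Prop) (T : gT -> R) h :
  biinvariant_preorder le -> normal_pred C -> mono_hom le C T ->
  mono_hom le C (fun g => T (h * g * h^-1)%g).
Proof.
move=> bo [sC nC] [TM Tle]; split=> g k Cg Ck.
  by rewrite -TM; [|exact: nC..]; rewrite !mulgA mulgVK.
move=> gk; apply: Tle; [exact: nC..|].
by apply: bo_mulr => //; apply: bo_mull.
Qed.

(** [D] is the common kernel of the two translation numbers. It contains the commutator of [c] and
    [d], and no power of its elements reaches [u] or [v], whose translation number is 1. *)
Lemma infinitesimals_normal (R : realType) (gT : groupType)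
    (le1 le2 : gT -> gT -> Prop) (C : gT -> Prop) (u v c d : gT) :
  biinvariant_preorder le1 -> biinvariant_preorder le2 -> normal_pred C ->
  order_unit le1 C u -> order_unit le2 C v ->
  C c -> C d -> (c * d <> d * c)%g ->
  exists D : gT -> Prop, [/\ normal_pred D, (exists2 g, D g & g <> 1%g) &
    forall g, D g -> [/\ C g, ~ order_unit le1 C g & ~ order_unit le2 C g]].
Proof.
move=> bo1 bo2 nC u1 u2 Cc Cd cd; have sC := nC.1.
have h1 := transl_num_mono_hom R bo1 sC u1; have h2 := transl_num_mono_hom R bo2 sC u2.
set T1 := transl_num R le1 u in h1; set T2 := transl_num R le2 v in h2.
have conj0 le T w h g : biinvariant_preorder le -> mono_hom le C T -> order_unit le C w ->
    T w = 1 :> R -> C g -> T g = 0 -> T (h * g * h^-1)%g = 0.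
  move=> bo hT [Cw w1 _ _] Tw Cg Tg.
  have := mono_hom_scale bo sC hT (mono_hom_conj h bo nC hT) Cw Cg Tw w1.
  by move=> ->; rewrite Tg mulr0.
(* Monotone homomorphisms are unique up to scaling, so these kernels are invariant
   under conjugation by all of gT, although u and v are only order units of C. *)
exists (fun g => [/\ C g, T1 g = 0 & T2 g = 0]); split.
- split; first split.
  + by split; [exact: sg1|exact: mh1 h1|exact: mh1 h2].
  + move=> g k [Cg g1 g2] [Ck k1 k2]; split; first exact: sgM.
      by rewrite h1.1// g1 k1 addr0.
    by rewrite h2.1// g2 k2 addr0.
  + move=> g [Cg g1 g2]; split; first exact: sgV.
      by rewrite (mhV sC h1)// g1 oppr0.
    by rewrite (mhV sC h2)// g2 oppr0.
  move=> h g [Cg g1 g2]; split; first exact: nC.2.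
    by apply: (conj0 le1 T1 u) => //; exact: (transl_num_unit R bo1 sC u1).
  by apply: (conj0 le2 T2 v) => //; exact: (transl_num_unit R bo2 sC u2).
- exists (c * d * (d * c)^-1)%g; last first.
    by move=> /divg1_eq.
  have Ccd := sgM sC Cc Cd; have Cdc := sgM sC Cd Cc; have CV := sgV sC Cdc.
  split; first exact: sgM.
    by rewrite h1.1// (mhV sC h1)// !h1.1// [X in _ - X]addrC subrr.
  by rewrite h2.1// (mhV sC h2)// !h2.1// [X in _ - X]addrC subrr.
- have inf le T w g : mono_hom le C T -> C g -> T g = 0 -> C w -> T w = 1 :> R ->
      ~ order_unit le C g.
    move=> hT Cg Tg Cw Tw [_ _ _ /(_ _ Cw)[n]].
    move=> /(hT.2 _ _ Cw (sgX n sC Cg)); rewrite Tw (mhX sC hT)// Tg mulr0.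
    by rewrite ler10.
  have [Cu _ _ _] := u1; have [Cv _ _ _] := u2.
  move=> g [Cg g1 g2]; split=> //.
    by apply: (inf le1 T1 u) => //; exact: (transl_num_unit R bo1 sC u1).
  by apply: (inf le2 T2 v) => //; exact: (transl_num_unit R bo2 sC u2).
Qed.

(** * Passing to normal subgroups with fewer sign patterns *)

Section Reduction.
Variables (R : realType) (gT : groupType) (act : gT -> R -> R).
Hypothesis sa : sparse_action act.
Local Notation lepoo := (act_le_pinfty act).
Local Notation lenoo := (act_le_ninfty act).

Lemma crossing_order_units f : crossing (act f) ->
  order_unit lepoo (fun _ => True) f /\ order_unit lenoo (fun _ => True) f.
Proof.
move=> cf; have [a [b fab]] := crossing_pairP sa cf.
have [ab fa fb fl fm fr] := fab.
have boP := act_le_pinfty_preorder sa; have boM := act_le_ninfty_preorder sa.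
split; split=> //.
- exists (b + 1) => x bx; rewrite (sa1 sa); apply/ltW/fr; lra.
- move=> [M fM]; pose x := Order.max M b + 1.
  have [Mx bx] : M <= x /\ b < x by rewrite /x maxEle; case: ifP => ?; split; lra.
  by have := fM _ Mx; rewrite (sa1 sa) leNgt fr.
- move=> g _; apply: (crossing_cofinal sa boP _ _ g cf).
    by move=> f' a' b' g' fab' /(crossing_pair_dominates sa fab')[].
  (* If g <= f fails at +oo, then f <= g there, and at a far point h(b) > b this gives h(b) <
     f(h(b)) <= g(h(b)). *)
  move=> {f a b cf fab ab fa fb fl fm fr g} f a b g fab gf.
  have [//|[M fg]] := bo_total boP g f.
  have [h hM] := dense_gt sa b (Order.max M b).
  exists h; have [Mx bx] : M < act h b /\ b < act h b by apply/andP; rewrite -gt_max.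
  exact: lt_le_trans (cp_right fab bx) (fg _ (ltW Mx)).
- exists (a - 1) => x bx; rewrite (sa1 sa); apply/ltW/fl; lra.
- move=> [M fM]; pose x := Order.min M a - 1.
  have [Mx bx] : x <= M /\ x < a by rewrite /x minEle; case: ifP => ?; split; lra.
  by have := fM _ Mx; rewrite (sa1 sa) leNgt fl.
- move=> g _; apply: (crossing_cofinal sa boM _ _ g cf).
    by move=> f' a' b' g' fab' /(crossing_pair_dominates sa fab')[].
  move=> {f a b cf fab ab fa fb fl fm fr g} f a b g fab gf.
  have [//|[M fg]] := bo_total boM g f.
  have [h hM] := dense_lt sa b (Order.min M a).
  exists h; have [Mx bx] : act h b < M /\ act h b < a by apply/andP; rewrite -lt_min.
  exact: lt_le_trans (cp_left fab bx) (fg _ (ltW Mx)).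
Qed.

(** Choose [h] so that all fixed points of w = huh^-1 lie beyond those of u. If u and w commuted, w
    would permute the fixed points of u without fixing any, and p, w(p), w(w(p)) would be three
    fixed points of u. *)
Lemma not_commute_conj u p : u <> 1%g -> act u p = p ->
  exists h, (u * (h * u * h^-1) <> (h * u * h^-1) * u)%g.
Proof.
move=> u1 up; have [lo [hi fixu]] := fixed_bounded sa u1.
have [h hlo] := dense_gt sa lo hi; exists h => com.
set w := (h * u * h^-1)%g in com.
have nofix q : act u q = q -> act w q <> q.
  move=> uq; rewrite -[q](actVK sa h) act_conj// => /(can_inj (actK sa h)) /fixu[lq _].
  have := fixu _ uq; move: lq; rewrite -(act_ltE sa h) (actVK sa); lra.
have fixw q : act u q = q -> act u (act w q) = act w q.
  by move=> uq; rewrite -(saM sa) com (saM sa) uq.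
have fw := fixw _ up; have fww := fixw _ fw.
have /eqP := nofix _ up; rewrite neq_lt => /orP[] lt; apply: u1.
  by apply: (sa_fix sa _ lt fww fw up); rewrite act_ltE.
by apply: (sa_fix sa lt _ up fw fww); rewrite act_ltE.
Qed.

Definition no_crossing (C : gT -> Prop) := forall c, C c -> ~ crossing (act c).

Lemma exists_normal_no_crossing (g0 : gT) : g0 <> 1%g ->
  exists C, [/\ normal_pred C, (exists2 g, C g & g <> 1%g) & no_crossing C].
Proof.
move=> g01.
have [nc|/existsNP[f /contrapT cf]] := pselect (forall f, ~ crossing (act f)).
  by exists (fun _ => True); split=> //; exists g0.
have [uP uM] := crossing_order_units cf.
have [a [b [ab fa _ _ fm _]]] := crossing_pairP sa cf.
have f1 : f <> 1%g.
  have := fm ((a + b) / 2) => + f1; rewrite f1 (sa1 sa); lra.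
have [h hcom] := not_commute_conj f1 fa.
have [D [nD D1 DP]] :=
  infinitesimals_normal R (act_le_pinfty_preorder sa) (act_le_ninfty_preorder sa)
  (normal_setT gT) uP uM I I hcom.
exists D; split=> // c /DP[_ + _]; apply: contra_not => cc.
by have [] := crossing_order_units cc.
Qed.

(** If some [c] were dominated by no power of k at +oo, or of k^-1 at -oo, then for large n the
    element k^-n c, or k^n c respectively, would have type (+,-,+), which [C] excludes. *)
Lemma expanding_order_units C k : normal_pred C -> no_crossing C -> C k ->
  expanding (act k) -> order_unit lepoo C k /\ order_unit lenoo C k^-1%g.
Proof.
move=> [sC _] ncC Ck [x1 [x2 [x12 kx1 kx2]]].
have k1 : k <> 1%g by move=> k1; move: kx1; rewrite k1 (sa1 sa) ltxx.
have [lo [hi fixk]] := fixed_bounded sa k1.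
pose m := Order.min x1 lo; pose M := Order.max x2 hi.
have [mx1 mlo x2M hiM] : [/\ m <= x1, m <= lo, x2 <= M & hi <= M].
  by rewrite /m /M minEle maxEle; do 2?case: ifP => ?; split; lra.
(* Were [x] moved up, then [x], [x1], [x2] would give [k] type (+,-,+). Beyond [M] the same argument
   applies to k^-1. *)
have down x : x < m -> act k x < x.
  move=> xm; have [//|xk|kx] := ltgtP (act k x) x.
    by exfalso; apply: (ncC _ Ck); exists x, x1, x2; split=> //; lra.
  by have := fixk _ kx; lra.
have up x : M < x -> x < act k x.
  move=> Mx; have [kx|//|kx] := ltgtP (act k x) x.
    exfalso; apply: (ncC _ (sgV sC Ck)); exists x1, x2, x.
    by split; [|lra|rewrite (act_ltV sa) !(act_gtV sa)].
  by have := fixk _ kx; lra.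
have iterup y K : M < y -> exists n0, forall n, (n0 <= n)%N -> K < act (k ^+ n)%g y.
  move=> My; have [||||n0 n0P] := @iter_up _ _ _ sa (fun t => M < t) k y (Order.max y K).
  - by [].
  - by rewrite lt_max My.
  - by move=> s t w; lra.
  - by move=> t Mt; have := up _ Mt; lra.
  by exists n0 => n /n0P; apply: le_lt_trans; rewrite le_max lexx orbT.
have iterdown y K : y < m -> exists n0, forall n, (n0 <= n)%N -> act (k ^+ n)%g y < K.
  move=> My; have [||||n0 n0P] := @iter_down _ _ _ sa (fun t => t < m) k y (Order.min y K).
  - by [].
  - by rewrite gt_min My.
  - by move=> s t w; lra.
  - by move=> t Mt; have := down _ Mt; lra.
  by exists n0 => n /n0P /lt_le_trans; apply; rewrite ge_min lexx orbT.
have mM : m < M by lra.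
split; split=> //.
- by exists (M + 1) => x Mx; rewrite (sa1 sa); apply/ltW/up; lra.
- move=> [N kN]; pose x := Order.max N M + 1.
  have [Nx Mx] : N <= x /\ M < x by rewrite /x maxEle; case: ifP => ?; split; lra.
  by have := kN _ Nx; rewrite (sa1 sa) leNgt up.
- move=> c Cc; have [n1 n1P] := iterup (M + 1) (act c (M + 1)) ltac:(lra).
  have [n2 n2P] := iterdown (m - 1) (act c (m - 1)) ltac:(lra).
  pose n := maxn n1 n2; exists n.
  have /n1P {}n1P : (n1 <= n)%N by rewrite leq_maxl.
  have /n2P {}n2P : (n2 <= n)%N by rewrite leq_maxr.
  apply: contrapT => /forallNP/(_ (M + 2))/existsNP[w /not_implyP[Mw /negP]].
  rewrite -ltNge => cw.
  apply: (ncC (k ^- n * c)%g); first by apply: (sgM sC) => //; apply: (sgV sC); exact: sgX.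
  exists (m - 1), (M + 1), w; rewrite !(saM sa).
  by split; [lra|lra|]; rewrite !(act_ltV sa) !(act_gtV sa).
- exact: sgV.
- exists (m - 1) => x xm; rewrite (sa1 sa) -(act_leE sa k) (actVK sa).
  by apply/ltW/down; lra.
- move=> [N kN]; pose x := Order.min N m - 1.
  have [Nx xm] : x < N /\ x < m by rewrite /x minEle; case: ifP => ?; split; lra.
  have := kN _ (ltW (lt_trans (down _ xm) Nx)).
  by rewrite (actK sa) (sa1 sa) leNgt down.
- move=> c Cc.
  (* With c(z) below [m] and c(y) above [M], the iterates of [k] carry c(z) below [z] and c(y) above
     [y]. *)
  pose z := Order.min m (act c^-1%g m) - 1; pose y := Order.max M (act c^-1%g M) + 1.
  have [zm czm] : z < m /\ act c z < m.
    by rewrite -(act_gtV sa) /z minEle; case: ifP => ?; split; lra.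
  have [My Mcy] : M < y /\ M < act c y.
    by rewrite -(act_ltV sa) /y maxEle; case: ifP => ?; split; lra.
  have [n1 n1P] := iterup _ y Mcy.
  have [n2 n2P] := iterdown _ z czm.
  pose n := maxn n1 n2; exists n.
  have /n1P {}n1P : (n1 <= n)%N by rewrite leq_maxl.
  have /n2P {}n2P : (n2 <= n)%N by rewrite leq_maxr.
  apply: contrapT => /forallNP/(_ (z - 1))/existsNP[w /not_implyP[wz /negP]].
  rewrite -ltNge expVgn (act_ltV sa) => cw.
  apply: (ncC (k ^+ n * c)%g); first by apply: sgM => //; apply: sgX.
  exists w, z, y; rewrite !(saM sa).
  by split; [lra|lra|].
Qed.

Definition one_signed (C : gT -> Prop) :=
  forall c, C c -> (forall x, x <= act c x) \/ (forall x, act c x <= x).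

Lemma not_expanding_one_signed C : normal_pred C ->
  (forall c, C c -> ~ expanding (act c)) -> one_signed C.
Proof.
move=> [sC _] neC c Cc.
have [|/existsNP[x /negP]] := pselect (forall x, x <= act c x); first by left.
rewrite -ltNge => cx; right => y; rewrite leNgt; apply/negP => yc.
have [xy|yx|xy] := ltgtP x y; last by move: cx yc; rewrite xy; lra.
  by apply: (neC _ Cc); exists x, y.
apply: (neC _ (sgV sC Cc)); exists y, x.
by rewrite (act_ltV sa) (act_gtV sa).
Qed.

Lemma exists_normal_one_signed (g0 : gT) : g0 <> 1%g ->
  exists C, [/\ normal_pred C, (exists2 g, C g & g <> 1%g) & one_signed C].
Proof.
move=> /exists_normal_no_crossing[C [nC [g Cg g1] ncC]].
have [ne|/existsNP[k /not_implyP[Ck /contrapT ek]]] :=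
    pselect (forall c, C c -> ~ expanding (act c)).
  by exists C; split=> //; [exists g|exact: not_expanding_one_signed].
have [uP uM] := expanding_order_units nC ncC Ck ek.
have [x [y [xy kx ky]]] := ek.
have [|p [_ _ kp]] := ivt_fixed (@sa_cont _ _ _ sa k) xy; first by nra.
have k1 : k <> 1%g by move=> k1; move: kx; rewrite k1 (sa1 sa) ltxx.
have [h hcom] := not_commute_conj k1 kp.
have [D [nD D1 DP]] :=
  infinitesimals_normal R (act_le_pinfty_preorder sa) (act_le_ninfty_preorder sa)
  nC uP uM Ck (nC.2 h _ Ck) hcom.
exists D; split=> //; apply: not_expanding_one_signed => // c /DP[Cc + _].
by apply: contra_not => ec; have [] := expanding_order_units nC ncC Cc ec.
Qed.

(** Up to inversion [d] moves no point down. Let e be a conjugate of d by h with all fixed points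
    beyond those of d. Then d^-1 e moves the fixed point x of d up and the fixed point h(x) of e
    down, against one-signedness. *)
Lemma one_signed_free C d x : normal_pred C -> one_signed C -> C d ->
  act d x = x -> d = 1%g.
Proof.
move=> [sC nC] osC; wlog dge : d / forall x, x <= act d x.
  move=> wl Cd dx; have [dge|dle] := osC _ Cd; first exact: wl.
  apply: invg_inj; rewrite invg1; apply: wl.
  - by move=> y; rewrite -(act_leE sa d) (actVK sa).
  - exact: sgV.
  - by rewrite -[in LHS]dx (actK sa).
move=> Cd dx; apply: contrapT => d1.
have [lo [hi fixd]] := fixed_bounded sa d1.
have [h hlo] := dense_gt sa lo hi.
have Ce := nC h _ Cd; set e := (h * d * h^-1)%g in Ce.
have efix y : act e y = y -> hi < y.
  rewrite -[y](actVK sa h) act_conj// => /(can_inj (actK sa h)) /fixd[lq _].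
  by rewrite -(act_ltE sa h) in lq; lra.
have egt y : y <= hi -> y < act e y.
  move=> yhi; rewrite lt_neqAle; apply/andP; split.
    by apply/negP => /eqP /esym /efix; lra.
  by rewrite -[y](actVK sa h) act_conj// act_leE.
have dgt y : hi <= y -> y < act d y.
  move=> yhi; rewrite lt_neqAle dge andbT.
  by apply/negP => /eqP /esym /fixd; lra.
have xhi := (fixd _ dx).2.
have ehx : act e (act h x) = act h x by rewrite act_conj// dx.
have hxhi := efix _ ehx.
have Cde : C (d^-1 * e)%g by apply: sgM => //; apply: sgV.
have [/(_ (act h x))|/(_ x)] := osC _ Cde; rewrite (saM sa).
  by rewrite ehx leNgt act_ltV// dgt// ltW.
by rewrite leNgt act_gtV// dx egt// ltW.
Qed.

Lemma exists_normal_free (g0 : gT) : g0 <> 1%g ->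
  exists C, [/\ normal_pred C, (exists2 g, C g & g <> 1%g) &
    forall c x, C c -> act c x = x -> c = 1%g].
Proof.
move=> /exists_normal_one_signed[C [nC C1 osC]]; exists C; split=> // c x Cc.
exact: one_signed_free nC osC Cc.
Qed.

End Reduction.

(** * The developing map of a free normal subgroup *)

Section Holder.
Variables (R : realType) (gT : groupType) (act : gT -> R -> R).
Hypothesis sa : sparse_action act.
Local Notation lepoo := (act_le_pinfty act).

Definition acts_freely (N : gT -> Prop) := forall c x, N c -> act c x = x -> c = 1%g.

(** c^-1 d has no fixed point, so by the intermediate value theorem it moves all points in the same
    direction. *)
Lemma free_lt N c d x y : subgroup_pred N -> acts_freely N -> N c -> N d ->
  act c x < act d x -> act c y < act d y.
Proof.
move=> sN frN Nc Nd cdx; set e := (c^-1 * d)%g.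
have Ne : N e by apply: (sgM sN) => //; exact: (sgV sN).
have ex : x < act e x by rewrite (saM sa) (act_gtV sa).
suff : y < act e y by rewrite (saM sa) (act_gtV sa).
have nofix z : act e z <> z.
  by move=> /(frN _ _ Ne) e1; move: ex; rewrite e1 (sa1 sa) ltxx.
rewrite ltNge le_eqVlt; apply/negP => /orP[/eqP/nofix//|ey].
have [xy|yx|xy] := ltgtP x y; last by move: ex ey; rewrite xy; lra.
  by have [|z [_ _ /nofix]] := ivt_fixed (@sa_cont _ _ _ sa e) xy; first by nra.
by have [|z [_ _ /nofix]] := ivt_fixed (@sa_cont _ _ _ sa e) yx; first by nra.
Qed.

(** Having no least positive element makes the values of the translation number dense, on which the
    continuity of the map theta rests. *)
Lemma exists_free_no_least (g0 : gT) : g0 <> 1%g ->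
  exists N t, [/\ normal_pred N, acts_freely N, N t & 0 < act t 0] /\
    forall d, N d -> 0 < act d 0 -> exists e, [/\ N e, 0 < act e 0 & act e 0 < act d 0].
Proof.
move=> /(exists_normal_free sa)[N [[sN nN] [g Ng g1] frN]].
have [t Nt t0] : exists2 t, N t & 0 < act t 0.
  have [gt0|gt0|/(frN _ _ Ng)//] := ltgtP (act g 0) 0; last by exists g.
  by exists g^-1%g; [exact: sgV|rewrite (act_gtV sa)].
(* A least positive element of N is central, so an element of gT with one fixed
   point has infinitely many, and gT itself acts freely with dense orbits. *)
have [nl|] := pselect (forall d, N d -> 0 < act d 0 ->
    exists e, [/\ N e, 0 < act e 0 & act e 0 < act d 0]).
  by exists N, t.
move=> /existsNP[s /not_implyP[Ns /not_implyP[s0 sleast]]].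
have least e : N e -> 0 < act e 0 -> act s 0 <= act e 0.
  by move=> Ne e0; rewrite leNgt; apply/negP => es; apply: sleast; exists e.
have pos e : N e -> (exists x, x < act e x) -> 0 < act e 0.
  move=> Ne [x ex]; have := @free_lt N 1%g e x 0 sN frN (sg1 sN) Ne.
  by rewrite !(sa1 sa); apply.
have posJ h : 0 < act (h * s * h^-1)%g 0.
  apply: pos; first exact: nN.
  by exists (act h 0); rewrite act_conj// act_ltE.
have com h : (h * s = s * h)%g.
  set c := (h * s * h^-1)%g.
  have Nc : N c by exact: nN.
  have [sc|sc] := eqVneq (act s 0) (act c 0).
    have : (s^-1 * c)%g = 1%g.
      apply: (frN _ 0); first by apply: (sgM sN) => //; exact: (sgV sN).
      by rewrite (saM sa) -sc actK.
    by move=> /mulg1_eq; rewrite invgK => sc1; rewrite [in RHS]sc1 /c mulgVK.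
  have sltc : act s 0 < act c 0 by rewrite lt_neqAle sc (least _ Nc (posJ h)).
  (* If hsh^-1 were strictly above s, conjugating back would put h^-1 s h strictly below s. *)
  have := least _ (nN h^-1%g _ Ns) (posJ h^-1%g).
  have := @free_lt N s c 0 (act h 0) sN frN Ns Nc sltc.
  rewrite act_conj// invgK !(saM sa) -(act_ltE sa h^-1%g) (actK sa).
  by rewrite leNgt => ->.
have sgt x : x < act s x.
  have := @free_lt N 1%g s 0 x sN frN (sg1 sN) Ns.
  by rewrite !(sa1 sa); apply.
exists (fun _ => True), s; split; first split=> //.
  move=> h p _ hp; have hs q : act h q = q -> act h (act s q) = act s q.
    by move=> hq; rewrite -(saM sa) com (saM sa) hq.
  exact: (sa_fix sa (sgt p) (sgt _) hp (hs _ hp) (hs _ (hs _ hp))).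
move=> d _ d0; have [e e1 e2] := sa_dense sa 0 d0.
by exists e.
Qed.

(** * The monotone map induced by the translation number *)

Section Development.
Variables (N : gT -> Prop) (t : gT).
Hypotheses (nN : normal_pred N) (frN : acts_freely N) (Nt : N t) (t0 : 0 < act t 0).
Hypothesis no_least : forall d, N d -> 0 < act d 0 ->
  exists e, [/\ N e, 0 < act e 0 & act e 0 < act d 0].

Let sN : subgroup_pred N. Proof. by case: nN. Qed.

(** [d] moves every point up, so the orbit of [0] is unbounded; by [free_lt] a comparison at [0]
    holds everywhere. *)
Lemma free_order_unit d : N d -> 0 < act d 0 -> order_unit lepoo N d.
Proof.
move=> Nd d0; have dgt x : x < act d x.
  have := @free_lt N 1%g d 0 x sN frN (sg1 sN) Nd.
  by rewrite !(sa1 sa); apply.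
split=> //.
- by exists 0 => x _; rewrite (sa1 sa) ltW.
- by move=> [M /(_ M (lexx _))]; rewrite (sa1 sa) leNgt dgt.
- move=> g Ng; have [||||n nP] := @iter_up _ _ _ sa (fun=> True) d 0 (act g 0) => //.
  exists n; exists 0 => x _; apply/ltW.
  by apply: (free_lt x sN frN Ng (sgX n sN Nd)); exact: nP.
Qed.

Local Notation T := (transl_num R lepoo t).

Let ut : order_unit lepoo N t. Proof. exact: free_order_unit. Qed.
Let boP : biinvariant_preorder lepoo. Proof. exact: act_le_pinfty_preorder. Qed.
Let hT : mono_hom lepoo N T. Proof. exact: transl_num_mono_hom. Qed.
Let Tt : T t = 1. Proof. exact: (transl_num_unit R boP sN ut). Qed.

(** As [d] is itself an order unit, some power of it exceeds [t], and then n T(d) >= T(t) = 1. *)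
Lemma transl_num_gt0 d : N d -> 0 < act d 0 -> 0 < T d.
Proof.
move=> Nd /(free_order_unit Nd)[_ _ _ /(_ _ Nt)[n]].
move=> /(hT.2 _ _ Nt (sgX n sN Nd)); rewrite Tt (mhX sN hT)// => nT.
rewrite ltNge; apply/negP => T0; have n0 : 0 <= n%:R :> R by [].
nra.
Qed.

Lemma transl_num_lt c d : N c -> N d -> (T c < T d) = (act c 0 < act d 0).
Proof.
have mono a b : N a -> N b -> act a 0 < act b 0 -> T a < T b.
  move=> Na Nb ab; have := @transl_num_gt0 (a^-1 * b)%g (sgM sN (sgV sN Na) Nb).
  rewrite (saM sa) (act_gtV sa) hT.1//; last exact: sgV.
  by rewrite (mhV sN hT)// => /(_ ab); lra.
move=> Nc Nd; apply/idP/idP; last exact: mono.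
move=> cd; have [//|/(mono _ _ Nd Nc)|dc] := ltgtP (act c 0) (act d 0).
  by move: cd; lra.
suff : (c^-1 * d = 1)%g.
  by move=> /mulg1_eq; rewrite invgK => dE; move: cd; rewrite dE ltxx.
apply: (frN (x := 0)); first by apply: (sgM sN) => //; exact: (sgV sN).
by rewrite (saM sa) -dc actK.
Qed.

(** Halving: for 0 < e < d in the order at [0], one of e and e^-1 d has translation number at most
    T(d)/2. *)
Lemma transl_num_small (eps : R) : 0 < eps -> exists2 e, N e & 0 < T e < eps.
Proof.
move=> eps0.
have half n : exists e, [/\ N e, 0 < act e 0 & (2 ^ n)%N%:R * T e <= 1].
  elim: n => [|n [d [Nd d0 Td]]].
    by exists t; rewrite Tt mulr1.
  have [e [Ne e0 ed]] := no_least Nd d0.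
  have [eh|eh] := lerP (2 * T e) (T d).
    exists e; split=> //; rewrite expnSr natrM -mulrA; apply: le_trans Td.
    by rewrite ler_wpM2l.
  exists (e^-1 * d)%g; split.
  - by apply: (sgM sN) => //; exact: (sgV sN).
  - by rewrite (saM sa) (act_gtV sa).
  rewrite expnSr natrM -mulrA; apply: le_trans Td; rewrite ler_wpM2l//.
  by rewrite hT.1 ?(mhV sN hT)//; [lra|exact: sgV].
have eps1 : 0 <= eps^-1 by rewrite invr_ge0 ltW.
have := archi_boundP eps1; set n := Num.bound _ => epsn.
have [e [Ne e0 Te]] := half n; exists e => //.
have T0 := transl_num_gt0 Ne e0; rewrite T0/=.
have n2 : n%:R < (2 ^ n)%N%:R :> R by rewrite ltr_nat ltn_expl.
have lt2 := lt_trans epsn n2; rewrite -(ltr_pM2l (le_lt_trans eps1 lt2)).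
by apply: (le_lt_trans Te); rewrite -ltr_pdivrMr// mul1r.
Qed.

Lemma transl_num_dense a b : a < b -> exists d, [/\ N d, a < T d & T d < b].
Proof.
move=> ab; have [|e Ne /andP[e0 eab]] := @transl_num_small (b - a); first by lra.
have /andP[f1 f2] := floor_itv (a / T e).
(* The first multiple of T(e) beyond [a]; it falls short of [b] because T(e) < b - a. *)
exists (zexpg e (Num.floor (a / T e) + 1)).
rewrite (mhZ sN hT)//; split; first exact: sg_zexpg.
  by rewrite -ltr_pdivrMr.
move: f1; rewrite intrD ler_pdivlMr//; nra.
Qed.

(** On the [N]-orbit of [0] this is the translation number itself ([developing_orbit]); the supremum
    extends it monotonically to the line. *)
Definition developing (x : R) : R := sup [set T d | d in [set d | N d /\ act d 0 <= x]].

Lemma exists_above x : exists2 d, N d & x <= act d 0.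
Proof.
have [||||n nP] := @iter_up _ _ _ sa (fun=> True) t 0 x => //.
  move=> y _; split=> //.
  have := @free_lt N 1%g t 0 y sN frN (sg1 sN) Nt.
  by rewrite !(sa1 sa); apply.
by exists (t ^+ n)%g; [exact: sgX|apply/ltW/nP].
Qed.

Lemma exists_below x : exists2 d, N d & act d 0 <= x.
Proof.
have [||||n nP] := @iter_down _ _ _ sa (fun=> True) t^-1%g 0 x => //.
  move=> y _; split=> //; rewrite (act_ltV sa).
  have := @free_lt N 1%g t 0 y sN frN (sg1 sN) Nt.
  by rewrite !(sa1 sa); apply.
by exists (t^-1 ^+ n)%g; [apply: (sgX n sN); exact: sgV|apply/ltW/nP].
Qed.

Let transl_num_le c d : N c -> N d -> act c 0 <= act d 0 -> T c <= T d.
Proof. by move=> Nc Nd; rewrite !leNgt transl_num_lt. Qed.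

Lemma developing_has_sup x : has_sup [set T d | d in [set d | N d /\ act d 0 <= x]].
Proof.
split; first by have [d Nd dx] := exists_below x; exists (T d), d.
have [d Nd xd] := exists_above x.
by exists (T d) => _ [c [Nc cx] <-]; apply: transl_num_le => //; exact: le_trans xd.
Qed.

Lemma developing_ge d x : N d -> act d 0 <= x -> T d <= developing x.
Proof.
by move=> Nd dx; apply: ub_le_sup; [exact: (developing_has_sup x).2|exists d].
Qed.

Lemma developing_le d x : N d -> x <= act d 0 -> developing x <= T d.
Proof.
move=> Nd xd; apply: ge_sup; first exact: (developing_has_sup x).1.
by move=> _ [c [Nc cx] <-]; apply: transl_num_le => //; exact: le_trans xd.
Qed.

Lemma developing_gt d x : N d -> T d < developing x -> act d 0 < x.
Proof. by move=> Nd; rewrite !ltNge; apply: contra; exact: developing_le. Qed.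

Lemma developing_lt d x : N d -> developing x < T d -> x < act d 0.
Proof. by move=> Nd; rewrite !ltNge; apply: contra; exact: developing_ge. Qed.

Lemma developing_orbit d : N d -> developing (act d 0) = T d.
Proof. by move=> Nd; apply/eqP; rewrite eq_le developing_le ?developing_ge. Qed.

Lemma developing_homo : {homo developing : x y / x <= y}.
Proof.
move=> x y xy; rewrite leNgt; apply/negP => /transl_num_dense[d [Nd yd dx]].
by have := developing_gt Nd dx; have := developing_lt Nd yd; lra.
Qed.

(** Dense values of [T] provide orbit points on both sides of [x] whose values are within [eps] of
    the value at [x]; monotonicity does the rest. *)
Lemma developing_continuous : continuous developing.
Proof.
move=> x; apply/cvgrPdist_lt => eps eps0.
have [|c [Nc c1 c2]] := @transl_num_dense (developing x - eps) (developing x); first by lra.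
have [|d [Nd d1 d2]] := @transl_num_dense (developing x) (developing x + eps); first by lra.
have xI : x \in `](act c 0), (act d 0)[.
  by rewrite in_itv /= developing_gt// developing_lt.
near=> y.
have : y \in `](act c 0), (act d 0)[ by near: y; exact: near_in_itvoo.
rewrite in_itv /= => /andP[/ltW/(developing_ge Nc) cy /ltW/(developing_le Nd) yd].
by rewrite ltr_distlC; lra.
Unshelve. all: by end_near.
Qed.

Lemma developing_surj : set_surj setT setT developing.
Proof.
move=> y _.
have [|c [Nc c1 c2]] := @transl_num_dense (y - 1) y; first by lra.
have [|d [Nd d1 d2]] := @transl_num_dense y (y + 1); first by lra.
have cd : act c 0 <= act d 0 by apply: ltW; rewrite -transl_num_lt//; lra.
have cont : {within `[act c 0, act d 0], continuous developing}.
  by apply: continuous_subspaceT; exact: developing_continuous.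
have [|x _ xy] := @IVT R developing _ _ y cd cont; last by exists x.
by rewrite !developing_orbit// minEle maxEle; case: ifP; lra.
Qed.

Lemma developing_shift c x : N c -> developing (act c x) = T c + developing x.
Proof.
have half e y : N e -> T e + developing y <= developing (act e y).
  move=> Ne; rewrite -lerBrDl; apply: ge_sup; first exact: (developing_has_sup y).1.
  move=> _ [d [Nd dy] <-]; rewrite lerBrDl -hT.1//.
  by apply: developing_ge; [exact: sgM|rewrite (saM sa) act_leE].
move=> Nc; apply/eqP; rewrite eq_le half// andbT.
by have := half _ (act c x) (sgV sN Nc); rewrite actK// (mhV sN hT)//; lra.
Qed.

(** Conjugation by [g] multiplies [T] by a = T(g t g^-1), by uniqueness up to scaling. This is the
    affine formula on the [N]-orbit of [0], and density extends it. *)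
Lemma developing_affine g : exists a b, 0 < a /\
  forall x, developing (act g x) = a * developing x + b.
Proof.
pose a := T (g * t * g^-1)%g; exists a, (developing (act g 0)).
have nN2 := nN.2.
have a0 : 0 < a.
  apply: transl_num_gt0; first exact: nN2.
  have [_ [M tM] _ _] := ut.
  have Nc := nN2 g _ Nt.
  have := @free_lt N 1%g (g * t * g^-1)%g (act g 0) 0 sN frN (sg1 sN) Nc.
  by rewrite act_conj// !(sa1 sa) act_ltE//; apply.
split=> // x.
have scale d : N d -> T (g * d * g^-1)%g = a * T d.
  move=> Nd; have ut1 : lepoo 1%g t by case: ut.
  exact: (mono_hom_scale boP sN hT (mono_hom_conj g boP nN hT) Nt Nd Tt ut1).
have orb d : N d -> developing (act g (act d 0)) = a * T d + developing (act g 0).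
  by move=> Nd; rewrite -act_conj// developing_shift ?scale//; exact: nN2.
(* If the two sides differed, an orbit point d(0) with value strictly in between would violate
   monotonicity after applying [g]. *)
have [lt|gt|//] := ltgtP (developing (act g x)) (a * developing x + developing (act g 0)).
  have [|d [Nd d1 d2]] :=
      @transl_num_dense ((developing (act g x) - developing (act g 0)) / a) (developing x).
    by rewrite ltr_pdivrMr//; lra.
  have := developing_homo (ltW (sa_lt sa g (developing_gt Nd d2))).
  rewrite orb//; move: d1; rewrite ltr_pdivrMr//; lra.
have [|d [Nd d1 d2]] :=
    @transl_num_dense (developing x) ((developing (act g x) - developing (act g 0)) / a).
  by rewrite ltr_pdivlMr//; lra.
have := developing_homo (ltW (sa_lt sa g (developing_lt Nd d1))).
rewrite orb//; move: d2; rewrite ltr_pdivlMr//; lra.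
Qed.

End Development.

Lemma sparse_action_affine : exists theta : R -> R,
  [/\ continuous theta, {homo theta : x y / x <= y}, set_surj setT setT theta &
    forall g, exists a b, 0 < a /\ forall x, theta (act g x) = a * theta x + b].
Proof.
have [g0 g01] : exists g0 : gT, g0 <> 1%g.
  have [g g0] := dense_gt sa 0 0; exists g => g1.
  by move: g0; rewrite g1 (sa1 sa) ltxx.
have [N [t [[nN frN Nt t0] nl]]] := exists_free_no_least g01.
exists (developing N t); split.
- exact: developing_continuous.
- exact: developing_homo.
- exact: developing_surj.
- exact: developing_affine.
Qed.

End Holder.

(** * From the interval to the line *)

Section HomeoGroup.
Context d (T : POrderedTopological.type d) (G : set (T -> T)).
Hypothesis hG : homeo_subgroup G.

(** The proof that [G] is a subgroup is a parameter of the type, so that the group structure below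
    can be attached to it. *)
Definition homeo_group of homeo_subgroup G := {f : T -> T | G f}.
Local Notation gT := (homeo_group hG).

Lemma homeo_group_inj (f g : gT) : sval f =1 sval g -> f = g.
Proof.
case: f g => [f Gf] [g Gg] /= /funext fg.
by move: Gf Gg; rewrite fg => Gf Gg; congr exist; exact: Prop_irrelevance.
Qed.

Lemma homeo_inverse (f : gT) :
  {g : T -> T | [/\ G g, cancel (sval f) g & cancel g (sval f)]}.
Proof.
apply: cid; have [Ghomeo _ _ GV] := hG; have Gf := svalP f.
by have [_ _ [g [_ fg gf]]] := Ghomeo _ Gf; exists g; split=> //; exact: GV fg gf.
Qed.

Definition homeo_one : gT := exist _ id (let: And4 _ G1 _ _ := hG in G1).
Definition homeo_mul (f g : gT) : gT :=
  exist _ (sval f \o sval g)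
    (let: And4 _ _ GM _ := hG in GM _ _ (svalP f) (svalP g)).
Definition homeo_inv (f : gT) : gT :=
  exist _ (sval (homeo_inverse f)) (let: And3 Gg _ _ := svalP (homeo_inverse f) in Gg).

HB.instance Definition _ := gen_eqMixin gT.
HB.instance Definition _ := gen_choiceMixin gT.

Lemma homeo_mulA : associative homeo_mul.
Proof. by move=> f g k; exact: homeo_group_inj. Qed.
Lemma homeo_mul1 : left_id homeo_one homeo_mul.
Proof. by move=> f; exact: homeo_group_inj. Qed.
Lemma homeo_1mul : right_id homeo_one homeo_mul.
Proof. by move=> f; exact: homeo_group_inj. Qed.
Lemma homeo_mulV : left_inverse homeo_one homeo_inv homeo_mul.
Proof.
by move=> f; apply: homeo_group_inj => x /=; case: (homeo_inverse f) => g /= [].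
Qed.
Lemma homeo_Vmul : right_inverse homeo_one homeo_inv homeo_mul.
Proof.
by move=> f; apply: homeo_group_inj => x /=; case: (homeo_inverse f) => g /= [].
Qed.

HB.instance Definition _ := isGroup.Build gT
  homeo_mulA homeo_mul1 homeo_1mul homeo_mulV homeo_Vmul.

End HomeoGroup.

(** * The conjugated action and its properties *)

Section Transfer.
Variables (R : realType).

Lemma homeo_I01_J01 (g : I01 R -> I01 R) (x : J01 R) :
  homeo_plus (I01 R) (I01 R) g -> val (g (J01_incl x)) \in J01 R.
Proof.
move=> [_ glt [g' [_ gg' g'g]]].
have bnd (y : I01 R) : 0 <= val y <= 1.
  by have := set_valP y; rewrite /I01 /= in_itv.
have I0 : (0 : R) \in I01 R by rewrite inE /I01 /= in_itv /= lexx ler01.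
have I1 : (1 : R) \in I01 R by rewrite inE /I01 /= in_itv /= lexx ler01.
pose i0 : I01 R := exist _ 0 I0; pose i1 : I01 R := exist _ 1 I1.
have /andP[x0 x1] : 0 < val x < 1.
  by have := set_valP x; rewrite /J01 /= in_itv.
rewrite inE /J01 /= in_itv /=; apply/andP; split.
  have /glt : (i0 < J01_incl x)%O by rewrite ltEsub.
  by rewrite ltEsub; apply: le_lt_trans; have /andP[] := bnd (g i0).
have /glt : (J01_incl x < i1)%O by rewrite ltEsub.
by rewrite ltEsub => /lt_le_trans; apply; have /andP[] := bnd (g i1).
Qed.

Variables (Gamma : set (I01 R -> I01 R)) (hGamma : homeo_subgroup Gamma).
Variables (h : J01 R -> R) (k : R -> J01 R).
Hypothesis (hh : homeo_plus (J01 R) R h).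
Hypotheses (k_cont : continuous k) (hK : cancel h k) (kK : cancel k h).
Local Notation gT := (homeo_group hGamma).

Let sub (g : gT) : homeo_plus (I01 R) (I01 R) (sval g).
Proof. by have [sub _ _ _] := hGamma; exact: sub (svalP g). Qed.

Definition restr (g : gT) (x : J01 R) : J01 R :=
  exist (fun y => y \in J01 R) _ (homeo_I01_J01 x (sub g)).
Definition hact (g : gT) (x : R) : R := h (restr g (k x)).

Lemma restrE g x : J01_incl (restr g x) = sval g (J01_incl x).
Proof. exact: val_inj. Qed.

Lemma restrM f g x : restr (f * g)%g x = restr f (restr g x).
Proof.
apply: val_inj; change (val (sval f (sval g (J01_incl x))) = val (restr f (restr g x))).
by rewrite -restrE.
Qed.

Lemma restr1 x : restr 1%g x = x.
Proof. exact: val_inj. Qed.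

Lemma restr_uniq g (r : J01 R -> J01 R) :
  (forall x, J01_incl (r x) = sval g (J01_incl x)) -> r = restr g.
Proof.
move=> rE; apply/funext => x; apply: val_inj.
by have := congr1 val (rE x); rewrite -restrE.
Qed.

Lemma restr_continuous g : continuous (restr g).
Proof.
apply: continuous_comp_initial.
have -> : set_val \o restr g = set_val \o (sval g \o @J01_incl R) by [].
have [gc _ _] := sub g.
have ic : continuous (@J01_incl R).
  by apply: continuous_comp_initial; exact: initial_continuous.
move=> x; apply: continuous_comp; last exact: initial_continuous.
by apply: continuous_comp; [exact: ic|exact: gc].
Qed.

(** The closure of an orbit is non-empty, closed and invariant, hence everything by minimality. *)
Lemma restr_dense (x : J01 R) (U : set (J01 R)) :
  minimal_set (restr_group Gamma) [set: J01 R] -> open U -> U !=set0 ->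
  exists g, U (restr g x).
Proof.
move=> [_ _ _ min] oU [u Uu].
pose O := [set restr g x | g in [set: gT]].
have : closure O = setT.
  apply: min => //.
  - by exists (restr 1%g x); apply: subset_closure; exists 1%g.
  - exact: closed_closure.
  - move=> r y [g Gg rE] Oy B rB; pose g' : gT := exist Gamma g Gg.
    have rg' : r = restr g' by exact: restr_uniq.
    rewrite rg' in rB *; have /Oy[_ [[f _ <-] /= Bf]] := restr_continuous rB.
    exists (restr g' (restr f x)); split=> //; exists (g' * f)%g => //.
    exact: restrM.
move=> /seteqP[_ /(_ u I)/(_ U)]; case; first exact: open_nbhs_nbhs.
by move=> _ [[g _ <-] Ug]; exists g.
Qed.

Lemma hact_sparse :
  minimal_set (restr_group Gamma) [set: J01 R] ->
  (forall g, Gamma g -> g <> id ->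
       ([set x : J01 R | g (J01_incl x) = J01_incl x] #<= `I_2)%card) ->
  sparse_action hact.
Proof.
move=> hmin hfix; have [hc hlt _] := hh.
have klt x y : x < y -> (k x < k y)%O.
  move=> xy; rewrite ltNge le_eqVlt; apply/negP => /orP[/eqP|/hlt].
    by move=> /(congr1 h); rewrite !kK; lra.
  by rewrite !kK; lra.
split.
- by move=> x; rewrite /hact restr1 kK.
- by move=> f g x; rewrite /hact hK restrM.
- move=> g x y /klt xy; apply: hlt; have [_ glt _] := sub g.
  by rewrite ltEsub; have := glt (J01_incl (k x)) (J01_incl (k y)); rewrite !ltEsub; apply;
    rewrite -ltEsub.
- move=> g x; apply: (@continuous_comp _ _ _ k (h \o restr g)); first exact: k_cont.
  by apply: (@continuous_comp _ _ _ (restr g) h); [exact: (@restr_continuous g)|exact: hc].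
- move=> g x y z xy yz gx gy gz; apply: contrapT => g1.
  have : sval g <> id by move=> gE; apply: g1; apply: homeo_group_inj => w; rewrite gE.
  (* An injection of the fixed points into a two-element set would separate the three points [k x],
     [k y], [k z]. *)
  move=> /(hfix _ (svalP g))/pcard_leP/injfunPex[f ffun finj].
  have fixk w : hact g w = w -> [set x : J01 R | sval g (J01_incl x) = J01_incl x] (k w).
    by move=> gw /=; rewrite -restrE -[in RHS]gw /hact hK.
  have fneq u v : hact g u = u -> hact g v = v -> u < v -> f (k u) <> f (k v).
    move=> /fixk gu /fixk gv uv /finj; rewrite !inE => /(_ gu gv)/(congr1 h).
    by rewrite !kK; lra.
  have flt u : hact g u = u -> (f (k u) < 2)%N by move=> /fixk /ffun.
  move: (fneq _ _ gx gy xy) (fneq _ _ gy gz yz) (fneq _ _ gx gz (lt_trans xy yz)).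
  move: (flt _ gx) (flt _ gy) (flt _ gz).
  by move: (f (k x)) (f (k y)) (f (k z)) => m n p; lia.
- move=> x a b ab.
  have [||g] := @restr_dense (k x) (h @^-1` `]a, b[%classic) hmin.
  + apply: open_comp => //; exact: itv_open.
  + by exists (k ((a + b) / 2)); rewrite /= kK in_itv /=; lra.
  by rewrite /= in_itv /= => /andP[ga gb]; exists g.
Qed.

Lemma hact_transport : transport_group h (restr_group Gamma) = range hact.
Proof.
apply/seteqP; split=> [f [r [g Gg rE] fE]|_ [g _ <-]].
  exists (exist Gamma g Gg) => //; apply/funext => x.
  by rewrite /hact -(restr_uniq (g := exist Gamma g Gg) rE) -fE kK.
exists (restr g); last by move=> x; rewrite /hact hK.
by exists (sval g) => //; [exact: svalP|move=> x; exact: restrE].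
Qed.

End Transfer.

Lemma affine_homeo_plus (R : realType) (f : R -> R) (a b : R) : 0 < a ->
  (forall x, f x = a * x + b) -> homeo_plus R R f.
Proof.
move=> a0 /funext ->; split.
- by move=> x; apply: cvgD; [apply: cvgMr; exact: cvg_id|exact: cvg_cst].
- by move=> x y xy; rewrite ltrD2r ltr_pM2l.
exists (fun x => a^-1 * (x - b)); split.
- move=> x; apply: cvgMr; apply: cvgB; [exact: cvg_id|exact: cvg_cst].
- by move=> x; rewrite addrK mulKf// gt_eqF.
- by move=> x; rewrite mulVKf ?subrK// gt_eqF.
Qed.

Theorem proposition5p8 (R : realType) (Gamma : set (I01 R -> I01 R))
    (hGamma : homeo_subgroup Gamma)
    (hmin : minimal_set (restr_group Gamma) [set: J01 R])
    (hfix : forall g, Gamma g -> g <> id ->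
       ([set x : J01 R | g (J01_incl x) = J01_incl x] #<= `I_2)%card)
    (h : J01 R -> R) (hh : homeo_plus (J01 R) R h) :
  exists G1 : set (R -> R),
    [/\ homeo_subgroup G1, G1 `<=` aff_plus R &
        semi_conjugate (transport_group h (restr_group Gamma)) G1].
Proof.
have [_ _ [k [kc hK kK]]] := hh.
have sa := hact_sparse hGamma hh kc hK kK hmin hfix.
rewrite (hact_transport hGamma hK kK).
pose act := @hact R Gamma hGamma h k; rewrite -/act in sa *.
have [theta [th_cont th_homo th_surj th_aff]] := sparse_action_affine sa.
have sectionE y : {x | theta x = y}.
  by apply: cid; have [x _ xy] := th_surj y I; exists x.
(* The choice of preimage is immaterial for elements of the group: the affine formula shows that
   theta(g(x)) depends only on theta(x). *)
pose rho f y := theta (f (sval (sectionE y))).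
have rhoE g x : rho (act g) (theta x) = theta (act g x).
  rewrite /rho; case: (sectionE (theta x)) => y /= yx.
  by have [a [b [_ thg]]] := th_aff g; rewrite !thg yx.
have theta_sec y : theta (sval (sectionE y)) = y by exact: svalP (sectionE y).
have rhoM f g : rho (act f) \o rho (act g) = rho (act (f * g)%g).
  apply/funext => y /=; rewrite -(theta_sec y) !rhoE.
  by rewrite (saM sa).
have rho1 : rho (act 1%g) = id.
  by apply/funext => y; rewrite -(theta_sec y) rhoE (sa1 sa).
have rho_aff g : exists a b, 0 < a /\ forall y, rho (act g) y = a * y + b.
  have [a [b [a0 thg]]] := th_aff g; exists a, b; split=> // y.
  by rewrite -{1}(theta_sec y) rhoE thg theta_sec.
pose G1 := [set rho (act g) | g in [set: homeo_group hGamma]].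
have G1homeo : G1 `<=` homeo_plus R R.
  by move=> _ [g _ <-]; have [a [b [a0 gE]]] := rho_aff g; exact: affine_homeo_plus a0 gE.
exists G1; split.
- split=> //.
  + by exists 1%g.
  + by move=> _ _ [f _ <-] [g _ <-]; exists (f * g)%g => //; rewrite rhoM.
  + move=> _ f' [f _ <-] ff' f'f; exists f^-1%g => //; apply/funext => y.
    rewrite -[LHS]ff'; congr f'; have := congr1 (@^~ y) (rhoM f f^-1%g).
    by rewrite /= mulgV rho1.
- move=> f G1f; split; first exact: G1homeo.
  by move: G1f => [g _ <-]; have [a [b [_ gE]]] := rho_aff g; exists a, b.
- exists rho, theta; split; split=> //.
  + by move=> _ [g _ <-]; exists g.
  + by move=> _ [g _ <-]; exists (act g) => //; exists g.
  + move=> _ _ [f _ <-] [g _ <-]; rewrite rhoM; congr rho; apply/funext => x /=.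
    by rewrite (saM sa).
  + by move=> _ [g _ <-]; apply/funext => x /=; rewrite rhoE.
Qed.
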